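(* Let $A,B,Q,\bar H(\pi),\bar F(\pi),\Pi_{\mathrm{unobs}}$ be as defined in the context, with $A$ Hurwitz, $\sigma(A_p)\cap\sigma(A_c)=\varnothing$ and $B_pC_c\neq0$. Consider the augmented system with state $\varphi=[z^\top,e^\top]^\top\in\mathbb{R}^{2n}$, $$\dot z=Az+B\big(z^\top Qz+\bar H(\pi)(z+e)\big),$$ $$\dot e=\big(\bar F(\pi)+L\bar H(\pi)\big)e+(B+L)\bar H(\pi)z+(B+L)(2z^\top Qe+e^\top Qe).$$ Let $\pi=\gamma\pi^\star$, where $\pi^\star\in\mathbb{R}^{n_p}\setminus\Pi_{\mathrm{unobs}}$ and $$0<\gamma<\frac{\lambda_{\min}(Y)}{4\|SB\|\,\|Q_p\pi^\star\|},\qquad A^\top S+SA=-Y,\quad Y\succ0.$$ Let the observer gain $L\in\mathbb{R}^{n\times1}$ be chosen such that $\bar F(\pi)+L\bar H(\pi)$ is Hurwitz. Consider positive definite $W_1,W_2\in\mathbb{R}^{n\times n}$ and let $P_1,P_2\succ0$ satisfy $$\bar F(\pi)^\top P_1+P_1\bar F(\pi)=-W_1,\qquad\big(\bar F(\pi)+L\bar H(\pi)\big)^\top P_2+P_2\big(\bar F(\pi)+L\bar H(\pi)\big)=-W_2.$$ Define the constants $c_1,c_3(\pi),c_4>0$ as $$c_1:=\frac{\min\{\sigma_{\min}(W_1),\sigma_{\min}(W_2)\}}{\max\{\sigma_{\max}(P_1),\sigma_{\max}(P_2)\}},\qquad c_3(\pi):=\frac{2\|P_1B\bar H(\pi)\|+2\|\bar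 H(\pi)^\top(B+L)^\top P_2\|}{\sqrt{\lambda_{\min}(P_1)\lambda_{\min}(P_2)}},$$ $$c_4:=\frac{2\|P_1B\|\|Q\|}{\lambda_{\min}(P_1)^{3/2}}+\frac{4\|P_2(B+L)\|\|Q\|}{\sqrt{\lambda_{\min}(P_1)}\,\lambda_{\min}(P_2)}+\frac{2\|P_2(B+L)\|\|Q\|}{\lambda_{\min}(P_2)^{3/2}}.$$ Suppose $c_2(\pi):=c_1-c_3(\pi)>0$. Then for any $\delta\in(0,c_2(\pi))$, an estimate of the region of attraction of the origin is given by $$\Omega_c:=\Big\{\varphi\in\mathbb{R}^{2n}\ \Big|\ V(\varphi)\le\Big(\frac{c_2(\pi)-\delta}{c_4}\Big)^2\Big\},\qquad V(\varphi)=z^\top P_1z+e^\top P_2e,$$ a sublevel set of the Lyapunov function $V$. In the interior of $\Omega_c$, the trajectories of $\varphi$ satisfy $\dot V(\varphi)\le-\delta V(\varphi)$.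
   Context: Given real matrices $A_p\in\mathbb{R}^{n_p\times n_p}$, $B_p$, $Q_p=Q_p^\top\in\mathbb{R}^{n_p\times n_p}$, $A_c\in\mathbb{R}^{n_c\times n_c}$, $B_c,C_c,D_c$ of compatible dimensions (scalar plant output), $n=n_p+n_c$, set $$A=\begin{bmatrix} A_p & B_p C_c \\ 0 & A_c \end{bmatrix},\quad B=\begin{bmatrix} B_p D_c \\ B_c \end{bmatrix}\in\mathbb{R}^{n\times1},\quad Q=\begin{bmatrix} Q_p & 0 \\ 0 & 0 \end{bmatrix},$$ and for $\pi\in\mathbb{R}^{n_p}$, $\bar H(\pi)=\begin{bmatrix}2\pi^\top Q_p&0\end{bmatrix}\in\mathbb{R}^{1\times n}$, $\bar F(\pi)=A+B\bar H(\pi)$. $\Pi_{\mathrm{unobs}}=\mathcal H_P\cup\mathcal H_C$ with $\mathcal H_P=\bigcup_{i=1}^{n_p}\{\pi\in\mathbb{R}^{n_p}\mid\pi^\top Q_pw_{p,i}=0\}$ and $\mathcal H_C=\bigcup_{j=1}^{n_c}\{\pi\in\mathbb{R}^{n_p}\mid\pi^\top Q_p(\lambda_{c,j}I-A_p)^{-1}B_pC_cw_{c,j}=0\}$, where $(\lambda_{p,i},w_{p,i})$ and $(\lambda_{c,j},w_{c,j})$ are the (complex) eigenpairs of $A_p$ and $A_c$. Norms are Euclidean / induced 2-norms; $\sigma_{\min},\sigma_{\max}$ are extreme singular values; $\succ0$ means symmetric positive definite. An estimate of the region of attraction is a set of initial conditions contained in the region of attraction of the origin $\varphi=0$ (the set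 of initial conditions whose trajectories converge to $0$). *)

(* Defs.v *)
From HB Require Import structures.
From mathcomp Require Import all_boot all_order all_algebra.
From mathcomp Require Import all_classical all_reals all_analysis.
From mathcomp Require Import complex.

Set Implicit Arguments.
Unset Strict Implicit.
Unset Printing Implicit Defensive.

Import Order.TTheory GRing.Theory Num.Theory.
Import numFieldNormedType.Exports.

Local Open Scope classical_set_scope.
Local Open Scope ring_scope.

Section Matrices.
Context {R : realType}.

Definition l2norm n (x : 'cV[R]_n) : R := Num.sqrt (\sum_i x i 0 ^+ 2).

Definition norm2 m n (M : 'M[R]_(m, n)) : R :=
  sup [set l2norm (M *m x) | x in [set x : 'cV[R]_n | l2norm x <= 1]].

(* Only applied to symmetric matrices, all of whose eigenvalues are real. *)
Definition lambda_min n (M : 'M[R]_n) : R := inf [set a | eigenvalue M a].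

Definition singular_values n (M : 'M[R]_n) : set R :=
  [set s | 0 <= s /\ eigenvalue (M^T *m M) (s ^+ 2)].
Definition sigma_min n (M : 'M[R]_n) : R := inf (singular_values M).
Definition sigma_max n (M : 'M[R]_n) : R := sup (singular_values M).

Definition posdef n (M : 'M[R]_n) : Prop :=
  M^T = M /\ forall x : 'cV[R]_n, x != 0 -> 0 < (x^T *m M *m x) 0 0.

Definition cplx m n (M : 'M[R]_(m, n)) : 'M[R[i]]_(m, n) :=
  map_mx (real_complex R) M.

Definition spectrum n (M : 'M[R]_n) : set R[i] :=
  [set l | eigenvalue (cplx M) l].

Definition Hurwitz n (M : 'M[R]_n) : Prop :=
  forall l, spectrum M l -> complex.Re l < 0.

(* The pairs (lam i, w i), i < n, list the complex eigenpairs of M: the lam i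
   are the eigenvalues counted with algebraic multiplicity, each w i is a
   (column) eigenvector for lam i, and the w i attached to an eigenvalue span
   its eigenspace.  When the eigenvalues are distinct, the last clause is
   automatic and each w i is unique up to scaling. *)
Definition eigenpairs n (M : 'M[R]_n)
    (lam : 'I_n -> R[i]) (w : 'I_n -> 'cV[R[i]]_n) : Prop :=
  [/\ char_poly (cplx M) = \prod_i ('X - (lam i)%:P)%R,
      forall i, w i != 0 /\ cplx M *m w i = lam i *: w i
    & forall (l : R[i]) (v : 'cV[R[i]]_n), cplx M *m v = l *: v ->
        exists a : 'I_n -> R[i], v = \sum_(i | lam i == l) a i *: w i].

End Matrices.

Section ClosedLoop.
Context {R : realType} {np nc m : nat}.
Implicit Types (Ap Qp : 'M[R]_np) (Bp : 'M[R]_(np, m)).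
Implicit Types (Ac : 'M[R]_nc) (Bc : 'cV[R]_nc).
Implicit Types (Cc : 'M[R]_(m, nc)) (Dc : 'cV[R]_m) (pi : 'cV[R]_np).

Definition clA Ap Bp Ac Cc : 'M[R]_(np + nc) :=
  block_mx Ap (Bp *m Cc) 0 Ac.

Definition clB Bp Bc Dc : 'cV[R]_(np + nc) := col_mx (Bp *m Dc) Bc.

Definition clQ Qp : 'M[R]_(np + nc) := block_mx Qp 0 0 0.

Definition Hbar Qp pi : 'rV[R]_(np + nc) := row_mx (2 *: (pi^T *m Qp)) 0.

Definition Pi_unobs Ap Bp Qp Cc (wp : 'I_np -> 'cV[R[i]]_np)
    (lamc : 'I_nc -> R[i]) (wc : 'I_nc -> 'cV[R[i]]_nc) : set 'cV[R]_np :=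
  (\bigcup_i [set pi | cplx (pi^T *m Qp) *m wp i = 0]) `|`
  (\bigcup_j [set pi | cplx (pi^T *m Qp) *m invmx ((lamc j)%:M - cplx Ap)
                         *m cplx (Bp *m Cc) *m wc j = 0]).

End ClosedLoop.

Section AugmentedSystem.
Context {R : realType} {n : nat}.
Implicit Types (A Q : 'M[R]_n) (B L : 'cV[R]_n).
Implicit Types (H : 'rV[R]_n) (phi : 'cV[R]_(n + n)).

(* Scalars such as z^T Q z are kept as 1 x 1 matrices. *)
Definition aug_field A B Q H L phi : 'cV[R]_(n + n) :=
  let z := usubmx phi in let e := dsubmx phi in
  col_mx
    (A *m z + B *m (z^T *m Q *m z + H *m (z + e)))
    ((A + B *m H + L *m H) *m e + (B + L) *m H *m z
       + (B + L) *m (2 *: (z^T *m Q *m e) + e^T *m Q *m e)).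

Definition V (P1 P2 : 'M[R]_n) phi : R :=
  let z := usubmx phi in let e := dsubmx phi in
  (z^T *m P1 *m z + e^T *m P2 *m e) 0 0.

Definition c1 (W1 W2 P1 P2 : 'M[R]_n) : R :=
  Num.min (sigma_min W1) (sigma_min W2) / Num.max (sigma_max P1) (sigma_max P2).

Definition c3 (P1 P2 : 'M[R]_n) B L H : R :=
  (2 * norm2 (P1 *m B *m H) + 2 * norm2 (H^T *m (B + L)^T *m P2))
  / Num.sqrt (lambda_min P1 * lambda_min P2).

Definition c4 (P1 P2 : 'M[R]_n) B L Q : R :=
  2 * norm2 (P1 *m B) * norm2 Q / lambda_min P1 `^ (3 / 2)
  + 4 * norm2 (P2 *m (B + L)) * norm2 Q
      / (Num.sqrt (lambda_min P1) * lambda_min P2)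
  + 2 * norm2 (P2 *m (B + L)) * norm2 Q / lambda_min P2 `^ (3 / 2).

End AugmentedSystem.

Section Trajectories.
Context {R : realType} {d : nat}.
Implicit Types (f : 'cV[R]_d -> 'cV[R]_d) (phi : R -> 'cV[R]_d).

Definition trajectory f (J : interval R) phi : Prop :=
  {within [set` J], continuous phi} /\
  forall t : R, interior [set` J] t -> is_derive t 1 phi (f (phi t)).

(* The trajectory from x0 must exist on all of [0, +oo[ (no finite escape) and
   converge to the origin. *)
Definition region_of_attraction f : set 'cV[R]_d :=
  [set x0 |
    (exists phi, trajectory f `[0, +oo[ phi /\ phi 0 = x0) /\
    (forall phi, trajectory f `[0, +oo[ phi -> phi 0 = x0 ->
       phi t @[t --> +oo] --> (0 : 'cV[R]_d))].

End Trajectories.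

(* Main.v *)
(* Along the flow, with z and e the two halves of the state, the Lyapunov
   equations and the Cauchy-Schwarz inequality give
     V' <= - c2 V + c4 V^(3/2),
   hence V' <= - delta V as soon as V <= ((c2 - delta) / c4)^2.  The rate
   delta / 2 is available on a strictly larger sublevel set, whose boundary a
   trajectory starting in Omega therefore cannot reach (mean value theorem at
   the first hitting time), and Groenwall gives exponential decay.  Existence on
   [0, +oo[: clipping the coordinates makes the polynomial field bounded and
   globally Lipschitz, so Picard iteration converges on the whole half-line, and
   the solution never leaves the region where clipping is the identity.
   That c3 and c4 are positive needs B, H and Q nonzero; this follows from the
   bound on gamma, which would be x / 0 = 0 otherwise. *)

Require Import Defs.
From mathcomp Require Import all_boot all_order all_algebra.
From mathcomp Require Import all_classical all_reals all_analysis.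
From mathcomp Require Import complex spectral sesquilinear.
From mathcomp Require Import ring lra.

Set Implicit Arguments.
Unset Strict Implicit.
Unset Printing Implicit Defensive.

Import Order.TTheory GRing.Theory Num.Theory.
Import numFieldNormedType.Exports.

Local Open Scope classical_set_scope.
Local Open Scope complex_scope.
Local Open Scope ring_scope.

(** * Euclidean norms and positive definite matrices *)

(** A real symmetric matrix is Hermitian over [R[i]], so a unitary [U] diagonalizes it with real
    eigenvalues; [y i] is the squared modulus of the [i]-th coordinate of [U *m x]. Any comparison
    of the quadratic form with the squared norm thus reduces to one eigenvalue at a time. *)
Lemma symmetric_quad_spectral (R : realType) (n : nat) (M : 'M[R]_n) :
  M^T = M ->
  exists2 d : 'I_n -> R, (forall i, eigenvalue M (d i)) &
    forall x : 'cV[R]_n, exists y : 'I_n -> R,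
      [/\ forall i, 0 <= y i, (x^T *m M *m x) 0 0 = \sum_i d i * y i
        & \sum_i x i 0 ^+ 2 = \sum_i y i].
Proof.
move=> symM; set C := cplx M.
have Creal : C \is a realmx.
  by apply/mxOverP => i j; rewrite mxE; apply/complex_realP; exists (M i j).
have Cherm : C \is hermsymmx.
  apply: realsym_hermsym => //; apply/is_hermitianmxP.
  by rewrite expr0 scale1r map_mx_id // /C /cplx map_trmx symM.
have /hermitian_normalmx/orthomx_spectralP CE := Cherm.
have /mxOverP dreal := hermitian_spectral_diag_real Cherm.
set U := spectralmx C in CE; set e := spectral_diag C in CE dreal.
have Uu : U \is unitarymx by exact: spectral_unitarymx.
have Uunit : U \in unitmx by exact: unitarymx_unit.
pose d i := complex.Re (e 0 i).
have dE i : (d i)%:C = e 0 i by apply: RRe_real; exact: dreal.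
exists d.
  move=> i; have : eigenvalue C (e 0 i).
    apply/eigenvalueP; exists (row i U).
      rewrite {1}CE -row_mul !mulmxA mulmxV // mul1mx.
      apply/rowP => j; rewrite !mxE (bigD1 i) //=.
      rewrite big1 ?addr0 ?mxE ?eqxx ?mulr1n // => k ki.
      by rewrite mxE eq_sym (negbTE ki) mulr0n mul0r.
    apply: contraTneq Uunit => r0; rewrite -row_free_unit.
    apply/negP => /row_freeP[V UV].
    have := congr1 (row i) UV; rewrite row_mul r0 mul0mx.
    move=> /rowP/(_ i); rewrite !mxE eqxx => /eqP.
    by rewrite eq_sym oner_eq0.
  (* Being real, the eigenvalue is already a root of the real characteristic polynomial. *)
  rewrite !eigenvalue_root_char -dE /C /cplx -map_char_poly.
  by rewrite fmorph_root.
move=> x; set u := cplx x; set v := U *m u.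
pose y i := complex.Re (`|v i 0| ^+ 2).
have yE i : (y i)%:C = `|v i 0| ^+ 2.
  by apply: RRe_real; rewrite realX // normr_real.
have uT : u^T = u ^t*%sesqui.
  apply/matrixP => i j; rewrite !mxE; apply/esym/CrealP.
  by apply/complex_realP; eexists.
exists y; split.
- by move=> i; rewrite -ler0c yE exprn_ge0.
- apply: (@complexI R).
  have -> : ((x^T *m M *m x) 0 0)%:C = (u^T *m C *m u) 0 0.
    by rewrite /u /C /cplx map_trmx -!map_mxM [RHS]mxE.
  rewrite uT {1}CE (invmx_unitary Uu) !mulmxA.
  have -> : u ^t*%sesqui *m U ^t*%sesqui = v ^t*%sesqui.
    by rewrite /v trmx_mul map_mxM.
  rewrite -mulmxA -/v mul_mx_diag mxE rmorph_sum; apply: eq_bigr => i _.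
  have vT : v ^t*%sesqui 0 i = (v i 0)^* by rewrite 2!mxE.
  by rewrite rmorphM /= dE yE normCK [X in X * _]mxE vT; ring.
- apply: (@complexI R).
  have -> : (\sum_i x i 0 ^+ 2)%:C = (u^T *m u) 0 0.
    rewrite mxE rmorph_sum; apply: eq_bigr => i _.
    by rewrite !mxE -rmorphM expr2.
  have -> : u^T *m u = v ^t*%sesqui *m v.
    rewrite uT /v trmx_mul map_mxM -(invmx_unitary Uu) mulmxA mulmxKV //.
  rewrite mxE rmorph_sum; apply: eq_bigr => i _.
  have vT : v ^t*%sesqui 0 i = (v i 0)^* by rewrite 2!mxE.
  by rewrite /= yE normCK vT mulrC.
Qed.

Section EuclideanNorm.
Context {R : realType}.

Lemma l2norm_ge0 n (x : 'cV[R]_n) : 0 <= l2norm x.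
Proof. exact: sqrtr_ge0. Qed.

Lemma sqr_l2norm n (x : 'cV[R]_n) : l2norm x ^+ 2 = \sum_i x i 0 ^+ 2.
Proof. by rewrite sqr_sqrtr // sumr_ge0 // => i _; exact: sqr_ge0. Qed.

Lemma dotxx_l2norm n (x : 'cV[R]_n) : (x^T *m x) 0 0 = l2norm x ^+ 2.
Proof. by rewrite sqr_l2norm mxE; apply: eq_bigr => i _; rewrite mxE expr2. Qed.

Lemma l2norm_eq0 n (x : 'cV[R]_n) : (l2norm x == 0) = (x == 0).
Proof.
rewrite -sqrf_eq0 sqr_l2norm psumr_eq0; last by move=> i _; exact: sqr_ge0.
apply/allP/eqP => [x0|-> i _]; last by rewrite /= mxE expr0n /= eqxx.
apply/colP => i; rewrite mxE; apply/eqP; rewrite -sqrf_eq0.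
by apply: (x0 i); rewrite mem_index_enum.
Qed.

Lemma l2norm_gt0 n (x : 'cV[R]_n) : (0 < l2norm x) = (x != 0).
Proof. by rewrite lt_neqAle l2norm_ge0 andbT eq_sym l2norm_eq0. Qed.

Lemma l2norm0 n : l2norm (0 : 'cV[R]_n) = 0.
Proof. by apply/eqP; rewrite l2norm_eq0. Qed.

Lemma l2normZ n (a : R) (x : 'cV[R]_n) : l2norm (a *: x) = `|a| * l2norm x.
Proof.
apply/eqP; rewrite -(@eqrXn2 _ 2) ?mulr_ge0 ?l2norm_ge0 //.
rewrite exprMn !sqr_l2norm real_normK ?num_real // mulr_sumr.
by apply/eqP; apply: eq_bigr => i _; rewrite mxE exprMn.
Qed.

Lemma le_coord_l2norm n (x : 'cV[R]_n) i : `|x i 0| <= l2norm x.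
Proof.
rewrite -(@ler_pXn2r _ 2) ?nnegrE ?l2norm_ge0 // real_normK ?num_real //.
rewrite sqr_l2norm (bigD1 i) //= lerDl.
by apply: sumr_ge0 => j _; exact: sqr_ge0.
Qed.

(* Lagrange's identity: the difference of the two sides is half of
   [\sum_(i, j) (a i * b j - a j * b i) ^+ 2]. *)
Lemma sum_Cauchy_Schwarz (I : finType) (a b : I -> R) :
  (\sum_i a i * b i) ^+ 2 <= (\sum_i a i ^+ 2) * (\sum_i b i ^+ 2).
Proof.
have : 0 <= \sum_i \sum_j (a i * b j - a j * b i) ^+ 2.
  by apply: sumr_ge0 => i _; apply: sumr_ge0 => j _; exact: sqr_ge0.
have -> : \sum_i \sum_j (a i * b j - a j * b i) ^+ 2 =
    2 * ((\sum_i a i ^+ 2) * (\sum_i b i ^+ 2) - (\sum_i a i * b i) ^+ 2).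
  transitivity (\sum_i \sum_j (a i ^+ 2 * b j ^+ 2 + b i ^+ 2 * a j ^+ 2
      - 2 * ((a i * b i) * (a j * b j)))).
    by apply: eq_bigr => i _; apply: eq_bigr => j _; ring.
  under eq_bigr do rewrite sumrB big_split /= -!mulr_sumr.
  rewrite sumrB big_split /= -!mulr_suml -mulr_sumr -mulr_suml; ring.
by rewrite pmulr_rge0 // subr_ge0.
Qed.

Lemma dot_Cauchy_Schwarz n (x y : 'cV[R]_n) :
  `|(x^T *m y) 0 0| <= l2norm x * l2norm y.
Proof.
rewrite -(@ler_pXn2r _ 2) ?nnegrE ?mulr_ge0 ?l2norm_ge0 //.
rewrite real_normK ?num_real // exprMn !sqr_l2norm mxE.
under eq_bigr do rewrite mxE.
exact: sum_Cauchy_Schwarz.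
Qed.

Lemma l2norm_scalar (x : 'cV[R]_1) : l2norm x = `|x 0 0|.
Proof. by rewrite /l2norm big_ord1 sqrtr_sqr. Qed.

Let frob m n (M : 'M[R]_(m, n)) := Num.sqrt (\sum_i \sum_j M i j ^+ 2).

Lemma l2norm_mul_bounded m n (M : 'M[R]_(m, n)) (x : 'cV[R]_n) :
  l2norm (M *m x) <= frob M * l2norm x.
Proof.
have s0 i : 0 <= \sum_j M i j ^+ 2 by apply: sumr_ge0 => j _; exact: sqr_ge0.
rewrite -(@ler_pXn2r _ 2) ?nnegrE ?mulr_ge0 ?l2norm_ge0 ?sqrtr_ge0 //.
rewrite exprMn !sqr_l2norm sqr_sqrtr; last by apply: sumr_ge0 => i _.
rewrite mulr_suml; apply: ler_sum => i _; rewrite mxE.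
exact: sum_Cauchy_Schwarz.
Qed.

(** The Frobenius norm is a finite bound, so the [sup] defining [norm2] is a genuine supremum and
    not the default value. *)
Lemma has_ubound_norm2 m n (M : 'M[R]_(m, n)) :
  has_ubound [set l2norm (M *m x) | x in [set x : 'cV[R]_n | l2norm x <= 1]].
Proof.
exists (frob M) => _ [x /= x1 <-]; apply: le_trans (l2norm_mul_bounded M x) _.
by rewrite -[leRHS]mulr1 ler_wpM2l // sqrtr_ge0.
Qed.

Lemma le_norm2 m n (M : 'M[R]_(m, n)) (x : 'cV[R]_n) :
  l2norm (M *m x) <= norm2 M * l2norm x.
Proof.
have [->|x0] := eqVneq x 0; first by rewrite mulmx0 !l2norm0 mulr0.
have lx : 0 < l2norm x by rewrite l2norm_gt0.
rewrite -ler_pdivrMr //.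
have -> : l2norm (M *m x) / l2norm x = l2norm (M *m ((l2norm x)^-1 *: x)).
  by rewrite -scalemxAr l2normZ mulrC ger0_norm // invr_ge0 ltW.
apply: ub_le_sup; first exact: has_ubound_norm2.
exists ((l2norm x)^-1 *: x) => //=.
by rewrite l2normZ ger0_norm ?invr_ge0 ?(ltW lx) // mulVf // gt_eqF.
Qed.

Lemma norm2_ge0 m n (M : 'M[R]_(m, n)) : 0 <= norm2 M.
Proof.
apply: (ub_le_sup (has_ubound_norm2 M)); exists 0 => /=.
  by rewrite l2norm0.
by rewrite mulmx0 l2norm0.
Qed.

Lemma norm2_eq0 m n (M : 'M[R]_(m, n)) : (norm2 M == 0) = (M == 0).
Proof.
apply/eqP/eqP => [M0|->].
  apply/matrixP => i j; rewrite mxE.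
  have := le_norm2 M (delta_mx j 0); rewrite M0 mul0r => Mj.
  have : l2norm (M *m delta_mx j 0 : 'cV_m) == 0.
    by rewrite eq_le Mj l2norm_ge0.
  by rewrite l2norm_eq0 -colE => /eqP/colP/(_ i); rewrite !mxE.
apply/eqP; rewrite eq_le norm2_ge0 andbT; apply: ge_sup.
  by exists 0; exists 0; rewrite /= ?mulmx0 l2norm0.
by move=> _ [x _ <-]; rewrite mul0mx l2norm0.
Qed.

Lemma norm2_gt0 m n (M : 'M[R]_(m, n)) : (0 < norm2 M) = (M != 0).
Proof. by rewrite lt_neqAle norm2_ge0 andbT eq_sym norm2_eq0. Qed.

End EuclideanNorm.

Section PositiveDefinite.
Context {R : realType} {n : nat}.
Implicit Types M : 'M[R]_n.

Lemma posdef_coercive M : posdef M ->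
  exists2 mu, 0 < mu &
    forall x : 'cV[R]_n, mu * l2norm x ^+ 2 <= (x^T *m M *m x) 0 0.
Proof.
move=> [symM Mgt0]; have [d dM dE] := symmetric_quad_spectral symM.
have d_gt0 i : 0 < d i.
  have /eigenvalueP[v vM v0] := dM i.
  have := Mgt0 v^T; rewrite trmx_eq0 => /(_ v0).
  rewrite trmxK vM -scalemxAl mxE -{1}[v]trmxK dotxx_l2norm.
  by rewrite pmulr_lgt0 // exprn_gt0 // l2norm_gt0 trmx_eq0.
(* Starting the minimum at [1] keeps it positive even when [n = 0]. *)
exists (\big[Num.min/1]_i d i).
  by elim/big_ind: _ => // x y x0 y0; rewrite lt_min x0.
move=> x; have [y [y0 -> yE]] := dE x.
rewrite sqr_l2norm yE mulr_sumr; apply: ler_sum => i _.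
by apply: ler_wpM2r => //; exact: bigmin_le_cond.
Qed.

Lemma coercive_eigenvalue_ge M mu a :
  (forall x : 'cV[R]_n, mu * l2norm x ^+ 2 <= (x^T *m M *m x) 0 0) ->
  eigenvalue M a -> mu <= a.
Proof.
move=> Mmu /eigenvalueP[v vM v0].
have := Mmu v^T; rewrite trmxK vM -scalemxAl mxE -{2}[v]trmxK dotxx_l2norm.
by rewrite ler_pM2r // exprn_gt0 // l2norm_gt0 trmx_eq0.
Qed.

Lemma posdef_eigenvalue_gt0 M a : posdef M -> eigenvalue M a -> 0 < a.
Proof.
move=> /posdef_coercive[mu mu0 /coercive_eigenvalue_ge Mmu] /Mmu.
exact: lt_le_trans.
Qed.

Lemma posdef_unitmx M : posdef M -> M \in unitmx.
Proof.
move=> Mpos; rewrite -row_free_unit -kermx_eq0; apply/negP => /negP K0.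
have : eigenvalue M 0 by rewrite /eigenvalue /eigenspace raddf0 subr0.
by move/(posdef_eigenvalue_gt0 Mpos); rewrite ltxx.
Qed.

Lemma lambda_min_le M (x : 'cV[R]_n) : posdef M ->
  lambda_min M * l2norm x ^+ 2 <= (x^T *m M *m x) 0 0.
Proof.
move=> Mpos; have [d dM /(_ x)[y [y0 -> yE]]] := symmetric_quad_spectral Mpos.1.
rewrite sqr_l2norm yE mulr_sumr; apply: ler_sum => i _.
apply: ler_wpM2r => //; apply: ge_inf => //=.
by exists 0 => a /= /(posdef_eigenvalue_gt0 Mpos)/ltW.
Qed.

(** Through this the eigenvalues of a positive definite matrix are singular values of it. *)
Lemma sqr_eigenvalue M a : M^T = M -> eigenvalue M a ->
  eigenvalue (M^T *m M) (a ^+ 2).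
Proof.
move=> -> /eigenvalueP[v vM v0]; apply/eigenvalueP; exists v => //.
by rewrite mulmxA vM -scalemxAl vM scalerA expr2.
Qed.

Lemma posdef_trmul M : posdef M -> posdef (M^T *m M).
Proof.
move=> Mpos; split; first by rewrite trmx_mul trmxK.
move=> x x0; rewrite mulmxA -trmx_mul -mulmxA dotxx_l2norm exprn_gt0 //.
rewrite l2norm_gt0; apply: contra x0 => /eqP Mx0.
by rewrite -(mulKmx (posdef_unitmx Mpos) x) Mx0 mulmx0.
Qed.

Lemma sigma_min_le M (x : 'cV[R]_n) : posdef M ->
  sigma_min M * l2norm x ^+ 2 <= (x^T *m M *m x) 0 0.
Proof.
move=> Mpos; have [d dM /(_ x)[y [y0 -> yE]]] := symmetric_quad_spectral Mpos.1.
rewrite sqr_l2norm yE mulr_sumr; apply: ler_sum => i _.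
apply: ler_wpM2r => //; apply: ge_inf; first by exists 0 => s [].
split; first exact/ltW/(posdef_eigenvalue_gt0 Mpos).
by apply: sqr_eigenvalue => //; case: Mpos.
Qed.

(** Bounds the set of singular values, so that [sigma_max] is a true supremum. *)
Lemma singular_value_le M s : singular_values M s -> s <= norm2 M.
Proof.
move=> [s0 /eigenvalueP[v vM v0]].
have lv : 0 < l2norm v^T by rewrite l2norm_gt0 trmx_eq0.
rewrite -(ler_pM2r lv); apply: le_trans (le_norm2 M v^T).
rewrite -(@ler_pXn2r _ 2) ?nnegrE ?mulr_ge0 ?l2norm_ge0 ?(ltW lv) //.
rewrite exprMn -!dotxx_l2norm trmx_mul !trmxK !mulmxA -(mulmxA v) vM.
by rewrite -scalemxAl [in leRHS]mxE.
Qed.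

Lemma le_sigma_max M (x : 'cV[R]_n) : posdef M ->
  (x^T *m M *m x) 0 0 <= sigma_max M * l2norm x ^+ 2.
Proof.
move=> Mpos; have [d dM /(_ x)[y [y0 -> yE]]] := symmetric_quad_spectral Mpos.1.
rewrite sqr_l2norm yE mulr_sumr; apply: ler_sum => i _.
apply: ler_wpM2r => //; apply: ub_le_sup.
  by exists (norm2 M) => s; exact: singular_value_le.
split; first exact/ltW/(posdef_eigenvalue_gt0 Mpos).
by apply: sqr_eigenvalue => //; case: Mpos.
Qed.

Hypothesis n_gt0 : (0 < n)%N.

(** In dimension 0 there are no eigenvalues and the infimum is the default [0]; hence [n_gt0]. The
    coercivity constant then bounds all eigenvalues away from [0]. *)
Lemma lambda_min_gt0 M : posdef M -> 0 < lambda_min M.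
Proof.
move=> Mpos; have [mu mu0 Mmu] := posdef_coercive Mpos.
apply: lt_le_trans mu0 _; apply: lb_le_inf.
  have [d dM _] := symmetric_quad_spectral Mpos.1.
  by exists (d (Ordinal n_gt0)); exact: dM.
by move=> a /=; exact: coercive_eigenvalue_ge.
Qed.

Lemma singular_values_neq0 M : posdef M -> singular_values M !=set0.
Proof.
move=> Mpos; have [d dM _] := symmetric_quad_spectral Mpos.1.
exists (d (Ordinal n_gt0)); split.
  exact/ltW/(posdef_eigenvalue_gt0 Mpos).
by apply: sqr_eigenvalue => //; case: Mpos.
Qed.

Lemma sigma_min_gt0 M : posdef M -> 0 < sigma_min M.
Proof.
move=> Mpos; have [mu mu0 Mmu] := posdef_coercive (posdef_trmul Mpos).
apply: (@lt_le_trans _ _ (Num.sqrt mu)); first by rewrite sqrtr_gt0.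
apply: lb_le_inf; first exact: singular_values_neq0.
move=> s [s0 /(coercive_eigenvalue_ge Mmu) mus].
by rewrite -(ger0_norm s0) -sqrtr_sqr ler_wsqrtr.
Qed.

Lemma sigma_max_gt0 M : posdef M -> 0 < sigma_max M.
Proof.
move=> Mpos; have [s sM] := singular_values_neq0 Mpos.
apply: (@lt_le_trans _ _ s); last first.
  apply: ub_le_sup => //.
  by exists (norm2 M) => t; exact: singular_value_le.
case: sM => s0 /(posdef_eigenvalue_gt0 (posdef_trmul Mpos)).
by rewrite exprn_even_gt0 //= lt0r s0 => ->.
Qed.

End PositiveDefinite.

(** * Derivative of the Lyapunov function *)

(** Scalar core of the estimate of [Vdot]. Here [a] and [b] stand for the norms of [z] and [e], [u]
    for the square root of [V], [r1] and [r2] for the square roots of [lambda_min P1] and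
    [lambda_min P2], [k1] to [k5] for the matrix norms in [c3] and [c4], and [t1] to [t5] for the
    coupling and cubic terms. *)
Lemma cubic_estimate (R : realFieldType)
    (r1 r2 u a b c w t1 t2 t3 t4 t5 k1 k2 k3 k4 k5 : R) :
  0 < r1 -> 0 < r2 -> 0 <= u -> 0 <= a -> 0 <= b -> r1 * a <= u -> r2 * b <= u ->
  0 <= k1 -> 0 <= k2 -> 0 <= k3 -> 0 <= k4 -> 0 <= k5 -> c * u ^+ 2 <= w ->
  t1 <= a * k1 * b -> t2 <= a * k2 * b -> t3 <= a * k3 * (a * k5 * a) ->
  t4 <= b * k4 * (a * k5 * b) -> t5 <= b * k4 * (b * k5 * b) ->
  - w + 2 * t1 + 2 * t2 + 2 * t3 + 4 * t4 + 2 * t5 <=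
  - (c - (2 * k1 + 2 * k2) / (r1 * r2)) * u ^+ 2
  + (2 * k3 * k5 / r1 ^+ 3 + 4 * k4 * k5 / (r1 * r2 ^+ 2)
     + 2 * k4 * k5 / r2 ^+ 3) * (u * u ^+ 2).
Proof.
move=> r1_gt0 r2_gt0 u0 a0 b0 au bu k1_ge0 k2_ge0 k3_ge0 k4_ge0 k5_ge0 cw.
move=> T1 T2 T3 T4 T5.
have {}au : a <= u / r1 by rewrite ler_pdivlMr // mulrC.
have {}bu : b <= u / r2 by rewrite ler_pdivlMr // mulrC.
have ab : a * b <= (u / r1) * (u / r2) by exact: ler_pM.
have aaa : a * (a * a) <= (u / r1) * ((u / r1) * (u / r1)).
  by apply: ler_pM; rewrite ?mulr_ge0 //; exact: ler_pM.
have bab : b * (a * b) <= (u / r2) * ((u / r1) * (u / r2)).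
  by apply: ler_pM; rewrite ?mulr_ge0 //; exact: ler_pM.
have bbb : b * (b * b) <= (u / r2) * ((u / r2) * (u / r2)).
  by apply: ler_pM; rewrite ?mulr_ge0 //; exact: ler_pM.
have {}ab := ler_wpM2l (addr_ge0 k1_ge0 k2_ge0) ab.
have {}aaa := ler_wpM2l (mulr_ge0 k3_ge0 k5_ge0) aaa.
have {}bab := ler_wpM2l (mulr_ge0 k4_ge0 k5_ge0) bab.
have {}bbb := ler_wpM2l (mulr_ge0 k4_ge0 k5_ge0) bbb.
(* In this form the goal is linear in the products just bounded. *)
have -> : - (c - (2 * k1 + 2 * k2) / (r1 * r2)) * u ^+ 2 +
   (2 * k3 * k5 / r1 ^+ 3 + 4 * k4 * k5 / (r1 * r2 ^+ 2)
     + 2 * k4 * k5 / r2 ^+ 3) * (u * u ^+ 2) =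
   - (c * u ^+ 2)
   + 2 * ((k1 + k2) * (u / r1 * (u / r2)))
   + 2 * (k3 * k5 * (u / r1 * (u / r1 * (u / r1))))
   + 4 * (k4 * k5 * (u / r2 * (u / r1 * (u / r2))))
   + 2 * (k4 * k5 * (u / r2 * (u / r2 * (u / r2)))).
  by field; rewrite !gt_eqF.
lra.
Qed.

Section LyapunovEstimate.
Context {R : realType}.

Lemma bilinear_le m n (M : 'M[R]_(m, n)) (x : 'cV[R]_m) (y : 'cV[R]_n) :
  `|(x^T *m M *m y) 0 0| <= l2norm x * norm2 M * l2norm y.
Proof.
rewrite -mulmxA -mulrA; apply: le_trans (dot_Cauchy_Schwarz _ _) _.
by rewrite ler_wpM2l ?l2norm_ge0 // le_norm2.
Qed.

Lemma tr_mx11 (a : 'M[R]_1) : a 0 0 = a^T 0 0.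
Proof. by rewrite mxE. Qed.

(** A scalar equals its transpose, so twice the form of [P *m F] is the form of its
    symmetrization. *)
Lemma lyapunov_quad n (P F W : 'M[R]_n) (x : 'cV[R]_n) :
  P^T = P -> F^T *m P + P *m F = - W ->
  2 * (x^T *m P *m (F *m x)) 0 0 = - (x^T *m W *m x) 0 0.
Proof.
move=> symP PF.
have -> : - (x^T *m W *m x) 0 0 = (x^T *m (- W) *m x) 0 0.
  by rewrite mulmxN mulNmx [in RHS]mxE.
rewrite -PF mulmxDr mulmxDl mulr_natl mulr2n [in RHS]mxE !mulmxA; congr (_ + _).
by rewrite tr_mx11 !trmx_mul trmxK symP !mulmxA.
Qed.

Lemma powR_three_halves (x : R) : 0 < x -> x `^ (3 / 2) = Num.sqrt x ^+ 3.
Proof.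
move=> x0; rewrite -powR12_sqrt ?ltW // -powR_mulrn ?powR_ge0 // -powRrM.
by congr (_ `^ _); lra.
Qed.

Context {n : nat}.
Variables (A Q P1 P2 W1 W2 : 'M[R]_n) (B L : 'cV[R]_n) (H : 'rV[R]_n).

(** The derivative of [V] along the field; the factors 2 come from merging the two halves of the
    product rule, by symmetry of [P1] and [P2]. *)
Definition Vdot (phi : 'cV[R]_(n + n)) : R :=
  let f := aug_field A B Q H L phi in
  2 * ((usubmx phi)^T *m P1 *m usubmx f) 0 0 +
  2 * ((dsubmx phi)^T *m P2 *m dsubmx f) 0 0.

Hypotheses (symP1 : P1^T = P1) (symP2 : P2^T = P2).
Hypothesis lyap1 : (A + B *m H)^T *m P1 + P1 *m (A + B *m H) = - W1.
Hypothesis lyap2 : (A + B *m H + L *m H)^T *m P2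
  + P2 *m (A + B *m H + L *m H) = - W2.

(** The Lyapunov equations absorb the two diagonal quadratic terms; what remains are the [z]-[e]
    couplings, measured by [c3], and the cubic terms, measured by [c4]. *)
Lemma VdotE phi (z := usubmx phi) (e := dsubmx phi) :
  Vdot phi = - (z^T *m W1 *m z) 0 0 - (e^T *m W2 *m e) 0 0
    + 2 * (z^T *m (P1 *m B *m H) *m e) 0 0
    + 2 * (z^T *m (H^T *m (B + L)^T *m P2) *m e) 0 0
    + 2 * (z^T *m (P1 *m B) *m (z^T *m Q *m z)) 0 0
    + 4 * (e^T *m (P2 *m (B + L)) *m (z^T *m Q *m e)) 0 0
    + 2 * (e^T *m (P2 *m (B + L)) *m (e^T *m Q *m e)) 0 0.
Proof.
rewrite -(lyapunov_quad _ symP1 lyap1) -(lyapunov_quad _ symP2 lyap2).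
rewrite /Vdot /aug_field -/z -/e col_mxKu col_mxKd.
have -> : (z^T *m (H^T *m (B + L)^T *m P2) *m e) 0 0 =
    (e^T *m P2 *m ((B + L) *m H *m z)) 0 0.
  by rewrite tr_mx11 !trmx_mul !trmxK symP2 !mulmxA.
have addE (a b : 'M[R]_1) : (a + b) 0 0 = a 0 0 + b 0 0 by rewrite mxE.
have scaleE c (a : 'M[R]_1) : (c *: a) 0 0 = c * a 0 0 by rewrite mxE.
have -> : A *m z + B *m (z^T *m Q *m z + H *m (z + e)) =
    (A + B *m H) *m z + B *m H *m e + B *m (z^T *m Q *m z).
  rewrite !mulmxDr !mulmxDl !mulmxA -!addrA; congr (_ + _).
  by rewrite [LHS]addrC -addrA.
(* These sums are made opaque so that distributivity does not break them up. *)
move: (B + L) (A + B *m H + L *m H) (A + B *m H) => G F2 F1.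
rewrite !mulmxDr -!scalemxAr !addE !scaleE !mulmxA; ring.
Qed.

Hypotheses (posP1 : posdef P1) (posP2 : posdef P2).
Hypotheses (posW1 : posdef W1) (posW2 : posdef W2).
Hypothesis n_gt0 : (0 < n)%N.

Lemma V_ge0 phi : 0 <= V P1 P2 phi.
Proof.
rewrite /V mxE addr_ge0 //; apply: le_trans (lambda_min_le _ _) => //;
  by rewrite mulr_ge0 ?sqr_ge0 // ltW // lambda_min_gt0.
Qed.

Lemma usubmx_le_V phi :
  Num.sqrt (lambda_min P1) * l2norm (usubmx phi) <= Num.sqrt (V P1 P2 phi).
Proof.
have lam1 := lambda_min_gt0 n_gt0 posP1.
have lam2 := lambda_min_gt0 n_gt0 posP2.
rewrite -[X in _ * X]ger0_norm ?l2norm_ge0 // -sqrtr_sqr -sqrtrM ?(ltW lam1) //.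
rewrite ler_wsqrtr // /V mxE -[leLHS]addr0 lerD ?lambda_min_le //.
apply: le_trans (lambda_min_le _ _) => //.
by rewrite mulr_ge0 ?sqr_ge0 // ltW.
Qed.

Lemma dsubmx_le_V phi :
  Num.sqrt (lambda_min P2) * l2norm (dsubmx phi) <= Num.sqrt (V P1 P2 phi).
Proof.
have lam1 := lambda_min_gt0 n_gt0 posP1.
have lam2 := lambda_min_gt0 n_gt0 posP2.
rewrite -[X in _ * X]ger0_norm ?l2norm_ge0 // -sqrtr_sqr -sqrtrM ?(ltW lam2) //.
rewrite ler_wsqrtr // /V mxE -[leLHS]add0r lerD ?lambda_min_le //.
apply: le_trans (lambda_min_le _ _) => //.
by rewrite mulr_ge0 ?sqr_ge0 // ltW.
Qed.

Lemma c1_gt0 : 0 < c1 W1 W2 P1 P2.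
Proof.
by rewrite divr_gt0 // ?lt_min ?lt_max ?sigma_min_gt0 ?sigma_max_gt0.
Qed.

(** Both sides are compared with [w] times the sum of the squared norms of [z] and [e]. *)
Lemma c1_V_le phi (z := usubmx phi) (e := dsubmx phi) :
  c1 W1 W2 P1 P2 * V P1 P2 phi <=
    (z^T *m W1 *m z) 0 0 + (e^T *m W2 *m e) 0 0.
Proof.
set w := Num.min (sigma_min W1) (sigma_min W2).
set s := Num.max (sigma_max P1) (sigma_max P2).
have s_gt0 : 0 < s by rewrite lt_max sigma_max_gt0.
have w_ge0 : 0 <= w by rewrite le_min !ltW ?sigma_min_gt0.
apply: (@le_trans _ _ (w * (l2norm z ^+ 2 + l2norm e ^+ 2))).
  rewrite /c1 -/w -/s mulrAC -mulrA ler_wpM2l // ler_pdivrMr // mulrC.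
  rewrite /V mxE mulrDr; apply: lerD.
    apply: le_trans (le_sigma_max _ posP1) _.
    by rewrite ler_wpM2r ?sqr_ge0 // le_max lexx.
  apply: le_trans (le_sigma_max _ posP2) _.
  by rewrite ler_wpM2r ?sqr_ge0 // le_max lexx orbT.
rewrite mulrDr; apply: lerD.
  apply: le_trans (sigma_min_le _ posW1).
  by rewrite ler_wpM2r ?sqr_ge0 // ge_min lexx.
apply: le_trans (sigma_min_le _ posW2).
by rewrite ler_wpM2r ?sqr_ge0 // ge_min lexx orbT.
Qed.

Lemma Vdot_le phi : Vdot phi <=
  - (c1 W1 W2 P1 P2 - c3 P1 P2 B L H) * V P1 P2 phi
  + c4 P1 P2 B L Q * (Num.sqrt (V P1 P2 phi) * V P1 P2 phi).
Proof.
have lam1 := lambda_min_gt0 n_gt0 posP1.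
have lam2 := lambda_min_gt0 n_gt0 posP2.
have vE : V P1 P2 phi = Num.sqrt (V P1 P2 phi) ^+ 2 by rewrite sqr_sqrtr ?V_ge0.
(* Every [lambda_min] and every [V] is turned into a power of its square root, to match the shape of
   [cubic_estimate]. *)
rewrite VdotE /c3 /c4 -[X in _ / (_ * X)](sqr_sqrtr (ltW lam2)) -opprD.
rewrite sqrtrM ?(ltW lam1) // !powR_three_halves //.
rewrite [X in _ * (_ * X)]vE [X in - _ * X + _]vE.
have bilin2 m p q (M : 'M[R]_(m, 1)) (x : 'cV[R]_m) (N : 'M[R]_(p, q)) y z :
    (x^T *m M *m (y^T *m N *m z)) 0 0 <=
    l2norm x * norm2 M * (l2norm y * norm2 N * l2norm z).
  apply: le_trans (ler_norm _) (le_trans (bilinear_le _ _ _) _).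
  rewrite l2norm_scalar ler_wpM2l ?mulr_ge0 ?l2norm_ge0 ?norm2_ge0 //.
  exact: bilinear_le.
apply: (cubic_estimate (a := l2norm (usubmx phi)) (b := l2norm (dsubmx phi)));
  rewrite ?sqrtr_gt0 ?sqrtr_ge0 ?l2norm_ge0 ?norm2_ge0 ?bilin2 //.
- exact: usubmx_le_V.
- exact: dsubmx_le_V.
- by rewrite -vE; exact: c1_V_le.
- exact: le_trans (ler_norm _) (bilinear_le _ _ _).
- exact: le_trans (ler_norm _) (bilinear_le _ _ _).
Qed.

End LyapunovEstimate.

Section Derivatives.
Context {R : realType}.

Lemma is_derive_mxP m n (X : R -> 'M[R]_(m, n)) (t : R) (D : 'M[R]_(m, n)) :
  is_derive t 1 X D <-> forall i j, is_derive t 1 (fun s => X s i j) (D i j).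
Proof.
split=> [[/[dup] dX /derivable_mxP dXij XD] i j|dXij].
  by split; [exact: dXij|rewrite -XD derive_mx // mxE].
have dX : derivable X t 1 by apply/derivable_mxP => i j; case: (dXij i j).
split=> //; rewrite derive_mx //; apply/matrixP => i j; rewrite mxE.
by case: (dXij i j).
Qed.

Lemma is_derive_quad n (P : 'M[R]_n) (X : R -> 'cV[R]_n) (D : 'cV[R]_n) (t : R) :
  P^T = P -> is_derive t 1 X D ->
  is_derive t 1 (fun s => ((X s)^T *m P *m X s) 0 0)
    (2 * ((X t)^T *m P *m D) 0 0).
Proof.
move=> symP /is_derive_mxP XD.
have quadE (x y : 'cV[R]_n) : (x^T *m P *m y) 0 0 =
    \sum_j \sum_i (P i j * (x i 0 * y j 0)).
  rewrite mxE; apply: eq_bigr => j _; rewrite mxE mulr_suml.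
  by apply: eq_bigr => i _; rewrite mxE; ring.
(* As a finite sum of products of coordinates, the form can be differentiated by the scalar
   rules. *)
have -> : (fun s => ((X s)^T *m P *m X s) 0 0) =
    \sum_j \sum_i (P i j *: ((fun s => X s i 0) * (fun s => X s j 0))).
  apply/funext => s; rewrite quadE fct_sumE; apply: eq_bigr => j _.
  by rewrite fct_sumE.
have XDi i : is_derive t 1 (fun s => X s i 0) (D i 0) by exact: XD.
apply: is_derive_eq.
rewrite mulr2n mulrDl mul1r {1}tr_mx11 !trmx_mul symP trmxK mulmxA !quadE.
rewrite -big_split /=; apply: eq_bigr => j _.
rewrite -big_split /=; apply: eq_bigr => i _.
by rewrite -mulrDr [in RHS]addrC [D i 0 * _]mulrC.
Qed.

Lemma is_derive_V n (A Q P1 P2 : 'M[R]_n) (B L : 'cV[R]_n) (H : 'rV[R]_n)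
    (phi : R -> 'cV[R]_(n + n)) (t : R) :
  P1^T = P1 -> P2^T = P2 ->
  is_derive t 1 phi (aug_field A B Q H L (phi t)) ->
  is_derive t 1 (V P1 P2 \o phi) (Vdot A Q P1 P2 B L H (phi t)).
Proof.
move=> symP1 symP2 /is_derive_mxP dphi.
have -> : V P1 P2 \o phi =
    (fun s => ((usubmx (phi s))^T *m P1 *m usubmx (phi s)) 0 0) +
    (fun s => ((dsubmx (phi s))^T *m P2 *m dsubmx (phi s)) 0 0).
  by apply/funext => s; rewrite /V /= mxE.
apply: is_deriveD; apply: is_derive_quad => //; apply/is_derive_mxP => i j.
  rewrite [X in is_derive _ _ _ X]mxE.
  have -> : (fun s => usubmx (phi s) i j) = (fun s => phi s (lshift n i) j).
    by apply/funext => s; rewrite mxE.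
  exact: dphi.
rewrite [X in is_derive _ _ _ X]mxE.
have -> : (fun s => dsubmx (phi s) i j) = (fun s => phi s (rshift n i) j).
  by apply/funext => s; rewrite mxE.
exact: dphi.
Qed.

End Derivatives.

(** * Global solutions of bounded Lipschitz equations *)

Section Picard.
Context {R : realType}.

(** Otherwise some natural [N] exceeds [c / (a - b)], and [N < 2 ^ N] contradicts the bound at
    [k = N]. *)
Lemma le_half_pow (a b c : R) : (forall k, a <= b + c / 2 ^+ k) -> a <= b.
Proof.
move=> abc; rewrite leNgt; apply/negP => ba.
have [c0|c0] := leP c 0.
  by have := abc 0%N; rewrite expr0 divr1; lra.
have /archi_boundP : 0 <= c / (a - b) by rewrite divr_ge0 ?subr_ge0 // ltW.
set N := Num.bound _ => cN; have := abc N; rewrite leNgt => /negP; apply.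
have N2 : N%:R < 2 ^+ N :> R by rewrite -natrX ltr_nat ltn_expl.
rewrite -ltrBDl ltr_pdivrMr ?exprn_gt0 // mulrC -ltr_pdivrMr ?subr_gt0 //.
exact: lt_trans N2.
Qed.

Lemma half_pow_limit (u : nat -> R) (c : R) :
  (forall k, `|u k.+1 - u k| <= c / 2 ^+ k) ->
  exists l, forall k, `|u k - l| <= 2 * c / 2 ^+ k.
Proof.
(* The radius is the sum of all remaining steps, so the intervals from [a k] to [b k] are nested;
   the limit is the supremum of their left ends. *)
move=> uc; pose a k := u k - 2 * c / 2 ^+ k; pose b k := u k + 2 * c / 2 ^+ k.
have pow2 k : 2 * c / 2 ^+ k = 2 * (2 * c / 2 ^+ k.+1).
  by rewrite exprS; field; rewrite expf_neq0.
have c0 : 0 <= c by have := le_trans (normr_ge0 _) (uc 0%N); rewrite divr1.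
have aS k : a k <= a k.+1.
  have := uc k; rewrite ler_distl /a => /andP[ukl _].
  have := pow2 k; rewrite -!mulrA; lra.
have bS k : b k.+1 <= b k.
  have := uc k; rewrite ler_distl /b => /andP[_ ukr].
  have := pow2 k; rewrite -!mulrA; lra.
have a_mono : {homo a : i j / (i <= j)%N >-> i <= j}.
  by apply: homo_leq => //; exact: le_trans.
have b_mono : {homo b : i j / (i <= j)%N >-> j <= i}.
  by apply: homo_leq => // x y z; exact: ge_trans.
have ab i j : a i <= b j.
  apply: le_trans (a_mono _ _ (leq_maxl i j)) _.
  apply: le_trans (b_mono _ _ (leq_maxr i j)).
  have : 0 <= 2 * c / 2 ^+ maxn i j by rewrite divr_ge0 ?mulr_ge0 ?exprn_ge0.
  by rewrite /a /b; lra.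
exists (sup (range a)) => k; rewrite distrC ler_distl; apply/andP; split.
  apply: ub_le_sup; last by exists k.
  by exists (b 0%N) => _ [i _ <-].
apply: ge_sup; first by exists (a 0%N); exists 0%N.
by move=> _ [i _ <-]; exact: ab.
Qed.

Lemma derivable_is_continuous (f : R -> R) (t : R) :
  derivable f t 1 -> {for t, continuous f}.
Proof. by move=> /derivable1_diffP/differentiable_continuous. Qed.

Lemma antiderivative_ge0 (g : R -> R) : continuous g ->
  exists2 G : R -> R, G 0 = 0 & forall t : R, 0 <= t -> is_derive t 1 G (g t).
Proof.
move=> cg; pose G0 (t : R) : R := \int[lebesgue_measure]_(s in `[-1, t]) g s.
have dG (t : R) : 0 <= t -> is_derive t 1 G0 (g t).
  move=> t0; have [] := @continuous_FTC1_closed R g (-1) t (t + 1).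
  - by rewrite ltrDl.
  - apply: continuous_compact_integrable; first exact: segment_compact.
    exact: continuous_subspaceT.
  - by apply: lt_le_trans t0; rewrite ltrN10.
  - exact: cg.
  by move=> dG0 G0E; apply: DeriveDef; rewrite -?derive1E.
exists (fun t : R => G0 t - G0 0); first by rewrite subrr.
move=> t t0; have dGt := dG _ t0.
have -> : (fun t : R => G0 t - G0 0) = G0 - cst (G0 0) by [].
by apply: is_derive_eq; rewrite subr0.
Qed.

(** Both [g + f] and [g - f] have nonnegative derivative, hence by the mean value theorem do not
    decrease. *)
Lemma derive_norm_le (f g df dg : R -> R) :
  (forall t : R, 0 <= t -> is_derive t 1 f (df t)) ->
  (forall t : R, 0 <= t -> is_derive t 1 g (dg t)) ->
  (forall t : R, 0 <= t -> `|df t| <= dg t) -> `|f 0| <= g 0 ->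
  forall t : R, 0 <= t -> `|f t| <= g t.
Proof.
move=> dfE dgE dfg fg0 t t0.
have pos (h dh : R -> R) : (forall s : R, 0 <= s -> is_derive s 1 h (dh s)) ->
    (forall s : R, 0 <= s -> 0 <= dh s) -> h 0 <= h t.
  move=> hE dh0; have [||c ct] := @MVT_segment R h dh 0 t t0.
  - by move=> s; rewrite in_itv /= => /andP[/ltW s0 _]; exact: hE.
  - apply: derivable_within_continuous => s; rewrite in_itv /= => /andP[s0 _].
    by have [] := hE s s0.
  move=> hc; rewrite -subr_ge0 hc subr0 mulr_ge0 // dh0 //.
  by move: ct; rewrite in_itv /= => /andP[].
rewrite ler_norml; move: fg0; rewrite ler_norml => /andP[f0 f1].
have Pp : (g + f) 0 <= (g + f) t.
  apply: (pos _ (dg + df)) => s s0.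
    by apply: is_deriveD; [exact: dgE|exact: dfE].
  have := dfg s s0; rewrite ler_norml !fctE => /andP[]; lra.
have Pm : (g - f) 0 <= (g - f) t.
  apply: (pos _ (dg - df)) => s s0.
    by apply: is_deriveB; [exact: dgE|exact: dfE].
  by rewrite !fctE; have := dfg s s0; rewrite ler_norml => /andP[]; lra.
by move: Pp Pm; rewrite !fctE => Pp Pm; apply/andP; split; lra.
Qed.

End Picard.

Section GlobalExistence.
Context {R : realType} {d : nat}.
Variables (F : 'cV[R]_d -> 'cV[R]_d) (M K : R).
Hypothesis F_bounded : forall x i, `|F x i 0| <= M.
Hypothesis M_ge0 : 0 <= M.
Hypothesis K_gt0 : 0 < K.
Hypothesis F_lipschitz : forall (x y : 'cV[R]_d) c,
  (forall i, `|x i 0 - y i 0| <= c) -> forall i, `|F x i 0 - F y i 0| <= K * c.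

(** The class preserved by Picard iteration: on it [F] along [x] is continuous, hence integrable. *)
Let lip (x : R -> 'cV[R]_d) := forall (s t : R) i,
  0 <= s -> 0 <= t -> `|x s i 0 - x t i 0| <= M * `|s - t|.

Let solves_along (x y : R -> 'cV[R]_d) := forall t : R, 0 <= t ->
  forall i, is_derive t 1 (fun s => y s i 0) (F (x t) i 0).

Let lip_solves_along x y : solves_along x y -> lip y.
Proof.
move=> xy s t i.
wlog st : s t / s <= t => [wst s0 t0|s0 t0].
  by have [st|/ltW ts] := leP s t; [|rewrite distrC [`|s - t|]distrC]; apply: wst.
have [||c ct yc] := @MVT_segment R (fun s => y s i 0) (fun s => F (x s) i 0) s t st.
- move=> u; rewrite in_itv /= => /andP[/ltW su _].
  by apply: xy; exact: le_trans su.
- apply: derivable_within_continuous => u; rewrite in_itv /= => /andP[su _].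
  by have [] := xy u (le_trans s0 su) i.
by rewrite distrC yc normrM distrC ler_wpM2r.
Qed.

Let integrate x0 x : lip x -> exists2 y, y 0 = x0 & solves_along x y.
Proof.
(* Reflecting time by the absolute value makes the integrand continuous on the whole line without
   changing it for [t >= 0]. *)
move=> xlip; have cF i : continuous (fun t : R => F (x `|t|) i 0).
  move=> t; apply/cvgrPdist_le => /= e e0.
  (* [M + 1] replaces [M], which may vanish, because the constant is divided by. *)
  have KM0 : 0 < K * (M + 1) by rewrite mulr_gt0 // ltr_wpDl.
  near=> s; apply: (@le_trans _ _ (K * ((M + 1) * `|t - s|))).
    apply: F_lipschitz => j; apply: le_trans (xlip _ _ _ _ _) _ => //.
    by apply: ler_pM => //; [rewrite lerDl|exact: ler_dist_dist].
  rewrite mulrA -ler_pdivlMl //.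
  near: s; apply: cvgr_dist_le; first exact: cvg_id.
  by rewrite mulr_gt0 ?invr_gt0.
have GP i := cid2 (antiderivative_ge0 (cF i)); pose G i := s2val (GP i).
have G0 i : G i 0 = 0 := s2valP (GP i).
have dG i : forall t : R, 0 <= t -> is_derive t 1 (G i) (F (x `|t|) i 0) :=
  s2valP' (GP i).
exists (fun t => \col_i (x0 i 0 + G i t)).
  by apply/colP => i; rewrite mxE G0 addr0.
move=> t t0 i.
have -> : (fun s => (\col_i (x0 i 0 + G i s)) i 0) = cst (x0 i 0) + G i.
  by apply/funext => s; rewrite mxE fctE.
have dGi := dG i t t0; rewrite ger0_norm // in dGi.
by apply: is_derive_eq; rewrite add0r.
Unshelve. all: by end_near. Qed.

Let is_derive_bound (c t : R) :
  is_derive t 1 (fun s => c * expR (2 * K * s)) (2 * K * (c * expR (2 * K * t))).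
Proof.
have -> : (fun s => c * expR (2 * K * s)) = c *: (expR \o (2 * K *: id)).
  by apply/funext => s; rewrite fctE.
by apply: is_derive_eq; rewrite /= /GRing.scale /=; ring.
Qed.

Let bound c t : R := c * expR (2 * K * t).

(* Weighting the differences by [expR (- 2 * K * t)] makes the Picard operator
   a contraction of ratio 1/2 on the whole half-line. *)
Lemma Picard_global x0 : exists2 x : R -> 'cV[R]_d, x 0 = x0 &
  forall t : R, 0 <= t -> is_derive t 1 x (F (x t)).
Proof.
(* The Picard step is chosen as a total function, with the junk value [x] outside [lip]. *)
have stepP (x : R -> 'cV[R]_d) : {y | lip x -> y 0 = x0 /\ solves_along x y}.
  apply/cid; case: (pselect (lip x)) => [/(integrate x0)[y y0 xy]|nlip].
    by exists y.
  by exists x => /nlip.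
pose step x := sval (stepP x); pose X k := iter k step (fun=> x0).
have Xlip k : lip (X k).
  elim: k => [s t i _ _|k IHk]; first by rewrite subrr normr0 mulr_ge0.
  by have [_ /lip_solves_along] := svalP (stepP (X k)) IHk.
have XS k : X k.+1 0 = x0 /\ solves_along (X k) (X k.+1).
  exact: (svalP (stepP (X k)) (Xlip k)).
(* With this [C] the derivative of [bound C] is at least [M] for [t >= 0], which dominates the first
   Picard step. *)
pose C := M / (2 * K).
have bound_half k t : bound (C / 2 ^+ k.+1) t * 2 = bound (C / 2 ^+ k) t.
  by rewrite /bound exprS; field; rewrite expf_neq0.
have C_ge0 : 0 <= C by rewrite divr_ge0 // mulr_ge0 // ltW.
have bound_ge0 k t : 0 <= bound (C / 2 ^+ k) t.
  by rewrite /bound mulr_ge0 ?expR_ge0 // divr_ge0 // exprn_ge0.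
have Xdiff k (t : R) i : 0 <= t ->
    `|X k.+1 t i 0 - X k t i 0| <= bound (C / 2 ^+ k) t.
  elim: k t i => [|k IHk] t i t0.
    apply: (derive_norm_le (f := fun s => X 1%N s i 0 - X 0%N s i 0) _
      (fun s _ => is_derive_bound (C / 2 ^+ 0) s)) t0.
    - move=> s s0; have [_ /(_ s s0 i) dX1] := XS 0%N.
      exact: (is_deriveB dX1 (is_derive_cst (x0 i 0) s 1)).
    - move=> s s0; rewrite /= subr0 expr0 divr1 /C.
      apply: le_trans (F_bounded _ _) _.
      rewrite mulrA [2 * K * _]mulrC divfK ?gt_eqF ?mulr_gt0 //.
      by rewrite ler_peMr // -expR0 ler_expR mulr_ge0 // mulr_ge0 // ltW.
    - have [-> _] := XS 0%N.
      by rewrite subrr normr0 -(expr0 2); exact: bound_ge0.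
  have [X1 dX1] := XS k; have [X2 dX2] := XS k.+1.
  apply: (derive_norm_le (f := fun s => X k.+2 s i 0 - X k.+1 s i 0) _
    (fun s _ => is_derive_bound (C / 2 ^+ k.+1) s)) t0.
  - move=> s s0; exact: (is_deriveB (dX2 s s0 i) (dX1 s s0 i)).
  - move=> s s0; apply: le_trans (F_lipschitz (fun j => IHk s j s0) i) _.
    by rewrite -bound_half /bound; lra.
  - by rewrite X1 X2 subrr normr0; exact: bound_ge0.
have limP (t : R) i : exists l, 0 <= t ->
    forall k, `|X k t i 0 - l| <= 2 * bound (C / 2 ^+ k) t.
  have [t0|t0] := leP 0 t; last by exists 0.
  have [k|l lP] := @half_pow_limit R (fun k => X k t i 0) (bound C t).
    by rewrite /bound mulrAC; exact: Xdiff.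
  by exists l => _ k; rewrite /bound mulrAC mulrA; exact: lP.
pose x t := \col_i sval (cid (limP t i)).
have xP (t : R) i k : 0 <= t -> `|X k t i 0 - x t i 0| <= 2 * bound (C / 2 ^+ k) t.
  by move=> t0; rewrite mxE; exact: (svalP (cid (limP t i)) t0 k).
have xlip : lip x.
  move=> s t i s0 t0; apply: (@le_half_pow _ _ _ (2 * bound C s + 2 * bound C t)).
  move=> k; have := xP s i k s0; have := xP t i k t0; have := Xlip k s t i s0 t0.
  rewrite /bound !ler_distl => /andP[? ?] /andP[? ?] /andP[? ?].
  by apply/andP; split; lra.
(* One more integration of the limit [x] gives [z], which agrees with [x] for [t >= 0]. The solution
   returned is [z]: it has a two-sided derivative at [0], whereas [x] is arbitrary at negative
   times. *)
have [z z0 xz] := integrate x0 xlip.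
have zdiff k (t : R) i : 0 <= t -> `|X k.+1 t i 0 - z t i 0| <= bound (C / 2 ^+ k) t.
  have [X1 dX1] := XS k => t0.
  apply: (derive_norm_le (f := fun s => X k.+1 s i 0 - z s i 0) _
    (fun s _ => is_derive_bound (C / 2 ^+ k) s)) t0.
  - by move=> s s0; exact: (is_deriveB (dX1 s s0 i) (xz s s0 i)).
  - move=> s s0; apply: le_trans (F_lipschitz (fun j => xP s j k s0) i) _.
    by rewrite /bound; lra.
  - by rewrite X1 z0 subrr normr0; exact: bound_ge0.
have zx (t : R) : 0 <= t -> x t = z t.
  move=> t0; apply/colP => i; apply/eqP; rewrite -subr_eq0 -normr_le0.
  apply: (@le_half_pow _ _ _ (2 * bound C t)) => k.
  have := zdiff k t i t0; have := xP t i k.+1 t0.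
  have := bound_half k t; rewrite /bound !ler_distl => ? /andP[? ?] /andP[? ?].
  by apply/andP; split; lra.
exists z => // t t0; apply/is_derive_mxP => i j.
by rewrite ord1 -zx //; exact: xz.
Qed.

End GlobalExistence.

(** * The clipped augmented field *)

Section BoundedLipschitz.
Context {R : realType} {d : nat}.

(** One constant is both a bound and a Lipschitz constant for the sup distance; boundedness is what
    makes the class stable under products. *)
Definition bounded_lipschitz (g : 'cV[R]_d -> R) := exists K : R,
  [/\ 0 <= K, forall x, `|g x| <= K & forall (x y : 'cV[R]_d) (c : R), 0 <= c ->
    (forall i, `|x i 0 - y i 0| <= c) -> `|g x - g y| <= K * c].

Definition mx_bounded_lipschitz m n (G : 'cV[R]_d -> 'M[R]_(m, n)) :=
  forall i j, bounded_lipschitz (fun x => G x i j).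

Lemma bounded_lipschitz_cst a : bounded_lipschitz (fun=> a).
Proof.
exists `|a|; split=> // x y c c0 _.
by rewrite subrr normr0 mulr_ge0.
Qed.

Lemma bounded_lipschitzD g h : bounded_lipschitz g -> bounded_lipschitz h ->
  bounded_lipschitz (fun x => g x + h x).
Proof.
move=> [K1 [K10 g1 g2]] [K2 [K20 h1 h2]]; exists (K1 + K2); split.
- exact: addr_ge0.
- by move=> x; apply: le_trans (ler_normD _ _) _; exact: lerD.
- move=> x y c c0 xy; rewrite opprD addrACA mulrDl.
  by apply: le_trans (ler_normD _ _) _; apply: lerD; [exact: g2|exact: h2].
Qed.

Lemma bounded_lipschitzM g h : bounded_lipschitz g -> bounded_lipschitz h ->
  bounded_lipschitz (fun x => g x * h x).
Proof.
move=> [K1 [K10 g1 g2]] [K2 [K20 h1 h2]]; exists (2 * (K1 * K2)); split.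
- by rewrite !mulr_ge0.
- move=> x; rewrite normrM; apply: (@le_trans _ _ (K1 * K2)).
    exact: ler_pM.
  by rewrite ler_peMl ?mulr_ge0 // ler1n.
- move=> x y c c0 xy.
  have -> : g x * h x - g y * h y = g x * (h x - h y) + (g x - g y) * h y by ring.
  apply: le_trans (ler_normD _ _) _; rewrite !normrM.
  have -> : 2 * (K1 * K2) * c = K1 * (K2 * c) + (K1 * c) * K2 by ring.
  by apply: lerD; apply: ler_pM => //; [exact: h2|exact: g2].
Qed.

Lemma mx_bounded_lipschitz_cst m n (M : 'M[R]_(m, n)) :
  mx_bounded_lipschitz (fun=> M).
Proof. by move=> i j; exact: bounded_lipschitz_cst. Qed.

Lemma mx_bounded_lipschitzD m n (G G' : 'cV[R]_d -> 'M[R]_(m, n)) :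
  mx_bounded_lipschitz G -> mx_bounded_lipschitz G' ->
  mx_bounded_lipschitz (fun x => G x + G' x).
Proof.
move=> Gl Gl' i j; under [X in bounded_lipschitz X]funext do rewrite mxE.
exact: bounded_lipschitzD.
Qed.

Lemma mx_bounded_lipschitzM m n p (G : 'cV[R]_d -> 'M[R]_(m, n))
    (G' : 'cV[R]_d -> 'M[R]_(n, p)) :
  mx_bounded_lipschitz G -> mx_bounded_lipschitz G' ->
  mx_bounded_lipschitz (fun x => G x *m G' x).
Proof.
move=> Gl Gl' i j; under [X in bounded_lipschitz X]funext do rewrite mxE.
elim: (index_enum _) => [|k s IHs].
  under [X in bounded_lipschitz X]funext do rewrite big_nil.
  exact: bounded_lipschitz_cst.
under [X in bounded_lipschitz X]funext do rewrite big_cons.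
by apply: bounded_lipschitzD IHs; exact: bounded_lipschitzM.
Qed.

Lemma mx_bounded_lipschitz_tr m n (G : 'cV[R]_d -> 'M[R]_(m, n)) :
  mx_bounded_lipschitz G -> mx_bounded_lipschitz (fun x => (G x)^T).
Proof.
by move=> Gl i j; under [X in bounded_lipschitz X]funext do rewrite mxE.
Qed.

Lemma mx_bounded_lipschitzZ m n a (G : 'cV[R]_d -> 'M[R]_(m, n)) :
  mx_bounded_lipschitz G -> mx_bounded_lipschitz (fun x => a *: G x).
Proof.
move=> Gl i j; under [X in bounded_lipschitz X]funext do rewrite mxE.
by apply: bounded_lipschitzM (Gl i j); exact: bounded_lipschitz_cst.
Qed.

Lemma mx_bounded_lipschitz_col m1 m2 n (G : 'cV[R]_d -> 'M[R]_(m1, n))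
    (G' : 'cV[R]_d -> 'M[R]_(m2, n)) :
  mx_bounded_lipschitz G -> mx_bounded_lipschitz G' ->
  mx_bounded_lipschitz (fun x => col_mx (G x) (G' x)).
Proof.
move=> Gl Gl' i j; under [X in bounded_lipschitz X]funext do rewrite mxE.
by case: (fintype.split i) => k.
Qed.

Lemma mx_bounded_lipschitz_usub m1 m2 n (G : 'cV[R]_d -> 'M[R]_(m1 + m2, n)) :
  mx_bounded_lipschitz G -> mx_bounded_lipschitz (fun x => usubmx (G x)).
Proof.
by move=> Gl i j; under [X in bounded_lipschitz X]funext do rewrite mxE.
Qed.

Lemma mx_bounded_lipschitz_dsub m1 m2 n (G : 'cV[R]_d -> 'M[R]_(m1 + m2, n)) :
  mx_bounded_lipschitz G -> mx_bounded_lipschitz (fun x => dsubmx (G x)).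
Proof.
by move=> Gl i j; under [X in bounded_lipschitz X]funext do rewrite mxE.
Qed.

Definition clip (r : R) (x : 'cV[R]_d) : 'cV[R]_d :=
  map_mx (fun a => Num.max (- r) (Num.min r a)) x.

Lemma clip_id r (x : 'cV[R]_d) : (forall i, `|x i 0| <= r) -> clip r x = x.
Proof.
move=> xr; apply/colP => i; rewrite mxE.
have := xr i; rewrite ler_norml => /andP[rx xr'].
by rewrite min_r // max_r.
Qed.

Lemma mx_bounded_lipschitz_clip r : 0 <= r -> mx_bounded_lipschitz (clip r).
Proof.
(* [r + 1] is at least the bound [r] and at least the Lipschitz constant [1]. *)
move=> r0 i j; rewrite ord1; exists (r + 1); split; first by rewrite addr_ge0.
  move=> x; rewrite mxE ler_norml ge_max le_max ge_min.
  by apply/andP; split; [apply/orP; left|apply/andP; split; [|apply/orP; left]]; lra.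
move=> x y c c0 /(_ i); rewrite !mxE => xy.
apply: (@le_trans _ _ c); last by rewrite ler_peMl // lerDr.
move: xy; rewrite !ler_distl; move: (x i 0) (y i 0) => a b.
by case: (leP r a) => ?; case: (leP r b) => ?; case: (leP (- r) r) => ?;
  case: (leP (- r) a) => ?; case: (leP (- r) b) => ? /andP[? ?];
  apply/andP; split; lra.
Qed.

End BoundedLipschitz.

Section AugmentedFlow.
Context {R : realType} {n : nat}.
Variables (A Q : 'M[R]_n) (B L : 'cV[R]_n) (H : 'rV[R]_n).

Lemma aug_field_clip_lipschitz r : 0 <= r ->
  mx_bounded_lipschitz (fun phi => aug_field A B Q H L (clip r phi)).
Proof.
move=> r0.
have c_bl := @mx_bounded_lipschitz_clip R (n + n) r r0.
by apply: mx_bounded_lipschitz_col;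
  repeat first [exact: c_bl | exact: mx_bounded_lipschitz_cst
  | apply: mx_bounded_lipschitz_usub | apply: mx_bounded_lipschitz_dsub
  | apply: mx_bounded_lipschitzD | apply: mx_bounded_lipschitzM
  | apply: mx_bounded_lipschitz_tr | apply: mx_bounded_lipschitzZ].
Qed.

Lemma aug_field_clip_flow r x0 : 0 <= r ->
  exists2 phi : R -> 'cV[R]_(n + n), phi 0 = x0 &
  forall t : R, 0 <= t -> is_derive t 1 phi (aug_field A B Q H L (clip r (phi t))).
Proof.
move=> r0; have fl := aug_field_clip_lipschitz r0.
pose k i := sval (cid (fl i 0)).
have kP i := svalP (cid (fl i 0)).
(* [K] dominates the constants of all coordinates and is positive; it serves as bound and as
   Lipschitz constant. *)
pose K := 1 + \sum_i k i.
have kK i : k i <= K.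
  rewrite /K (bigD1 i) //= addrCA lerDl addr_ge0 // sumr_ge0 // => j _.
  by have [] := kP j.
have K1 : 1 <= K by rewrite lerDl sumr_ge0 // => j _; have [] := kP j.
have K0 : 0 < K by exact: lt_le_trans K1.
apply: (@Picard_global R _ (fun phi => aug_field A B Q H L (clip r phi)) K K) => //.
- by move=> x i; have [_ b _] := kP i; exact: le_trans (b x) (kK i).
- exact: ltW.
- move=> x y c xy i; have c0 : 0 <= c := le_trans (normr_ge0 _) (xy i).
  have [_ _ l] := kP i; apply: le_trans (l x y c c0 xy) _.
  by apply: ler_wpM2r => //; exact: kK.
Qed.

End AugmentedFlow.

(** * Exponential decay and the region of attraction *)

Section Decay.
Context {R : realType}.

(* At the first time where [g] reaches [rho] the mean value theorem on the
   preceding interval would give [rho <= g 0]. *)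
Lemma decay_below_level (g : R -> R) (rho delta : R) :
  {within `[0, +oo[, continuous g} -> 0 <= delta ->
  (forall t : R, 0 <= t -> 0 <= g t) -> g 0 < rho ->
  (forall t : R, 0 < t -> g t <= rho ->
    exists2 D, is_derive t 1 g D & D <= - delta * g t) ->
  forall t : R, 0 <= t -> g t < rho /\ g t <= g 0 * expR (- delta * t).
Proof.
move=> cg delta0 g_ge0 g0 dg.
have cg0 t : {within `[0, t], continuous g}.
  apply: continuous_subspaceW cg => x /=.
  by rewrite !in_itv /= => /andP[-> _].
(* The mean value theorem asks for the derivative as a function; it is chosen pointwise, with value
   [0] where nothing is known. *)
have [dgf dgfP] : {D : R -> R | forall t : R, 0 < t -> g t <= rho ->
    is_derive t 1 g (D t) /\ D t <= - delta * g t}.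
  suff H t : {D | 0 < t -> g t <= rho -> is_derive t 1 g D /\ D <= - delta * g t}.
    by exists (fun t => sval (H t)) => t; exact: (svalP (H t)).
  apply/cid; have [t0|_] := ltP 0 t; last by exists 0.
  have [gt|_] := leP (g t) rho; last by exists 0.
  by have [D ? ?] := dg t t0 gt; exists D.
have below (t : R) : 0 <= t -> g t < rho.
  move=> t0; rewrite ltNge; apply/negP => rho_gt.
  pose E : set R := [set s | 0 <= s /\ rho <= g s].
  have infE : has_inf E by split; [exists t|exists 0 => s []].
  set tau := inf E.
  have tau0 : 0 <= tau by apply: lb_le_inf; [exists t|move=> s []].
  have rho_tau : rho <= g tau.
    (* Otherwise continuity keeps [g] below [rho] near [tau], although [E] has points arbitrarily
       close to its infimum. *)
    rewrite leNgt; apply/negP => tau_rho.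
    have /subspace_continuousP/(_ tau) := cg.
    rewrite /= in_itv /= tau0 => /(_ isT)/cvgrPdist_lt/(_ (rho - g tau)).
    rewrite subr_gt0 => /(_ tau_rho); rewrite near_withinE => /nbhs_ballP[e /= e0 ge].
    have [s [s0 rho_s] s_tau] := inf_adherent e0 infE.
    have tau_s : tau <= s by apply: ge_inf; [case: infE|].
    have := ge s; rewrite /ball /= in_itv /= s0 => /(_ _ isT).
    rewrite !ltr_distl => /(_ _)/andP[].
      by apply/andP; split; lra.
    by rewrite /from_subspace => ? ?; lra.
  have tau_gt0 : 0 < tau.
    by rewrite lt_neqAle tau0 andbT; apply: contraTneq rho_tau => <-; rewrite -ltNge.
  have [s|//|c] := @MVT R g dgf 0 tau tau_gt0.
    rewrite in_itv /= => /andP[s0 s_tau].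
    apply: (dgfP s s0 _).1; rewrite leNgt; apply/negP => /ltW rho_s.
    move: s_tau; rewrite ltNge => /negP; apply.
    by apply: ge_inf; [case: infE|split=> //; exact: ltW].
  rewrite in_itv /= => /andP[c0 c_tau] gc.
  have gc_rho : g c <= rho.
    rewrite leNgt; apply/negP => /ltW rho_s.
    move: c_tau; rewrite ltNge => /negP; apply.
    by apply: ge_inf; [case: infE|split=> //; exact: ltW].
  have [_ dgc] := dgfP c c0 gc_rho.
  have : dgf c <= 0.
    by apply: le_trans dgc _; rewrite mulNr oppr_le0 mulr_ge0 // g_ge0 // ltW.
  rewrite -(ler_pM2r tau_gt0) mul0r; move: gc; rewrite subr0; lra.
move=> t t0; split; first exact: below.
rewrite mulNr expRN ler_pdivlMr ?expR_gt0 //.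
have [->|t_neq0] := eqVneq t 0; first by rewrite mulr0 expR0 mulr1.
have t_gt0 : 0 < t by rewrite lt0r t_neq0.
(* Groenwall: the product of [g] and [E] has nonpositive derivative. *)
pose E s := expR (delta * s).
have dE (s : R) : is_derive s 1 E (delta * E s).
  have -> : E = expR \o (delta *: id) by [].
  by apply: is_derive_eq; rewrite /= /GRing.scale /= /E; ring.
have [s||c] := @MVT R (g * E) (fun s => g s * (delta * E s) + E s * dgf s) 0 t t_gt0.
- rewrite in_itv /= => /andP[s0 _].
  have [gs _] := dgfP s s0 (ltW (below s (ltW s0))).
  exact: is_deriveM.
- move=> x; apply: continuousM; first exact: cg0.
  apply: continuous_subspaceT => s; apply: derivable_is_continuous.
  by have [] := dE s.
rewrite in_itv /= subr0 => /andP[c0 _] gc.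
have [_ dgc] := dgfP c c0 (ltW (below c (ltW c0))).
have Ec : 0 < E c by exact: expR_gt0.
have : (g * E) t - (g * E) 0 <= 0.
  rewrite gc pmulr_lle0 //.
  have -> : g c * (delta * E c) + E c * dgf c = E c * (dgf c + delta * g c) by ring.
  by rewrite pmulr_rle0 // -lerBrDr sub0r -mulNr.
by rewrite !fctE /E mulr0 expR0 mulr1 subr_le0.
Qed.

Lemma continuous_fsum (T : topologicalType) (I : finType) (f : I -> T -> R) :
  (forall i, continuous (f i)) -> continuous (fun x => \sum_i f i x).
Proof.
move=> cf; elim: (index_enum I) => [|i s IHs].
  under [X in continuous X]funext do rewrite big_nil.
  by move=> x; exact: cvg_cst.
under [X in continuous X]funext do rewrite big_cons.
by move=> x; apply: continuousD; [exact: cf|exact: IHs].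
Qed.

Lemma continuous_quad n (T : topologicalType) (P : 'M[R]_n) (X : T -> 'cV[R]_n) :
  (forall i, continuous (fun x => X x i 0)) ->
  continuous (fun x => ((X x)^T *m P *m X x) 0 0).
Proof.
move=> cX; under [X in continuous X]funext do rewrite mxE.
apply: continuous_fsum => j.
under [X in continuous X]funext do rewrite mxE.
move=> x; apply: continuousM; last exact: cX.
move: x; apply: continuous_fsum => i.
under [X in continuous X]funext do rewrite mxE.
by move=> x; apply: continuousM; [exact: cX|exact: cvg_cst].
Qed.

Lemma continuous_V n (P1 P2 : 'M[R]_n) : continuous (V P1 P2).
Proof.
have -> : V P1 P2 = fun phi => ((usubmx phi)^T *m P1 *m usubmx phi) 0 0 +
    ((dsubmx phi)^T *m P2 *m dsubmx phi) 0 0.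
  by apply/funext => phi; rewrite /V mxE.
move=> phi; apply: continuousD; move: phi; apply: continuous_quad => i;
  under [X in continuous X]funext do rewrite mxE; exact: coord_continuous.
Qed.

End Decay.

Section RegionOfAttraction.
Context {R : realType} {n : nat}.
Variables (A Q P1 P2 W1 W2 : 'M[R]_n) (B L : 'cV[R]_n) (H : 'rV[R]_n).
Hypothesis lyap1 : (A + B *m H)^T *m P1 + P1 *m (A + B *m H) = - W1.
Hypothesis lyap2 : (A + B *m H + L *m H)^T *m P2
  + P2 *m (A + B *m H + L *m H) = - W2.
Hypotheses (posP1 : posdef P1) (posP2 : posdef P2).
Hypotheses (posW1 : posdef W1) (posW2 : posdef W2).
Hypothesis n_gt0 : (0 < n)%N.
Hypothesis c4_gt0 : 0 < c4 P1 P2 B L Q.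

Let c2 := c1 W1 W2 P1 P2 - c3 P1 P2 B L H.
(** The level at which [c4] times the square root of [V] equals [c2 - delta]. For [delta < c2] it
    decreases in [delta], so a slower rate buys a strictly larger sublevel set. *)
Let rho delta := ((c2 - delta) / c4 P1 P2 B L Q) ^+ 2.
Let f := aug_field A B Q H L.

Lemma Vdot_le_decay delta phi : delta <= c2 -> V P1 P2 phi <= rho delta ->
  Vdot A Q P1 P2 B L H phi <= - delta * V P1 P2 phi.
Proof.
move=> delta_c2 V_rho.
have := Vdot_le Q posP1.1 posP2.1 lyap1 lyap2 posP1 posP2 posW1 posW2 n_gt0 phi.
move=> /le_trans; apply.
rewrite -/c2 mulrA -mulrDl; apply: ler_wpM2r; first exact: V_ge0.
have : Num.sqrt (V P1 P2 phi) <= (c2 - delta) / c4 P1 P2 B L Q.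
  rewrite -[leRHS]ger0_norm; last by rewrite divr_ge0 ?subr_ge0 // ltW.
  by rewrite -sqrtr_sqr ler_wsqrtr.
rewrite ler_pdivlMr // mulrC; lra.
Qed.

Let kappa := (Num.sqrt (lambda_min P1))^-1 + (Num.sqrt (lambda_min P2))^-1.

Lemma coord_le_V (phi : 'cV[R]_(n + n)) i :
  `|phi i 0| <= kappa * Num.sqrt (V P1 P2 phi).
Proof.
have r1 : 0 < Num.sqrt (lambda_min P1) by rewrite sqrtr_gt0 lambda_min_gt0.
have r2 : 0 < Num.sqrt (lambda_min P2) by rewrite sqrtr_gt0 lambda_min_gt0.
have k (a : R) : 0 <= (Num.sqrt a)^-1 * Num.sqrt (V P1 P2 phi).
  by rewrite mulr_ge0 ?invr_ge0 ?sqrtr_ge0.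
rewrite -{1}[phi]vsubmxK mxE mulrDl; case: (fintype.split i) => j;
  apply: le_trans (le_coord_l2norm _ _) _.
  apply: ler_wpDr; first exact: k.
  by rewrite (ler_pdivlMl _ _ r1); exact: usubmx_le_V.
apply: ler_wpDl; first exact: k.
by rewrite (ler_pdivlMl _ _ r2); exact: dsubmx_le_V.
Qed.

Lemma norm_le_V (phi : 'cV[R]_(n + n)) : `|phi| <= kappa * Num.sqrt (V P1 P2 phi).
Proof.
have k0 : 0 <= kappa by rewrite addr_ge0 ?invr_ge0 ?sqrtr_ge0.
rewrite [leLHS]/Num.Def.normr /= mx_normrE; apply: bigmax_le.
  by rewrite mulr_ge0 ?sqrtr_ge0.
by move=> [i j] _; rewrite ord1; exact: coord_le_V.
Qed.

Lemma V_gt0 phi : phi != 0 -> 0 < V P1 P2 phi.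
Proof.
move=> phi0; rewrite lt0r V_ge0 // andbT; apply: contra phi0 => /eqP V0.
by rewrite -normr_le0; have := norm_le_V phi; rewrite V0 sqrtr0 mulr0.
Qed.

(** The start lies strictly below [rho delta'], so [decay_below_level] applies. The equation is only
    asked for where [V] is at most [rho delta'], which lets the lemma cover solutions of the clipped
    equation too. *)
Lemma V_trajectory_decay delta delta' (phi : R -> 'cV[R]_(n + n)) :
  0 < delta' -> delta' < delta -> delta < c2 ->
  {within `[0, +oo[, continuous phi} -> V P1 P2 (phi 0) <= rho delta ->
  (forall t : R, 0 < t -> V P1 P2 (phi t) <= rho delta' ->
    is_derive t 1 phi (f (phi t))) ->
  forall t : R, 0 <= t -> V P1 P2 (phi t) < rho delta' /\
    V P1 P2 (phi t) <= V P1 P2 (phi 0) * expR (- delta' * t).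
Proof.
move=> delta'0 dd' dc2 cphi phi0 dphi.
apply: (@decay_below_level R (V P1 P2 \o phi)).
- apply/subspace_continuousP => x x0.
  have /subspace_continuousP/(_ x x0) phix := cphi.
  apply: cvg_comp; [exact: phix|exact: continuous_V].
- exact: ltW.
- by move=> t _; exact: V_ge0.
- apply: le_lt_trans phi0 _; rewrite /rho ltr_pXn2r // ?nnegrE.
  + by rewrite ltr_pM2r ?invr_gt0 //; lra.
  + by rewrite divr_ge0 ?(ltW c4_gt0) //; lra.
  + by rewrite divr_ge0 ?(ltW c4_gt0) //; lra.
- move=> t t0 Vt; exists (Vdot A Q P1 P2 B L H (phi t)).
    by apply: is_derive_V; [exact: posP1.1|exact: posP2.1|exact: dphi].
  by apply: Vdot_le_decay => //; lra.
Qed.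

Lemma cvg_trajectory delta (phi : R -> 'cV[R]_(n + n)) : 0 < delta ->
  (forall t : R, 0 <= t ->
    V P1 P2 (phi t) <= V P1 P2 (phi 0) * expR (- delta * t)) ->
  phi t @[t --> +oo] --> (0 : 'cV[R]_(n + n)).
Proof.
move=> delta0 Vphi; apply/cvgr0Pnorm_le => e e0.
have k0 : 0 <= kappa by rewrite addr_ge0 ?invr_ge0 ?sqrtr_ge0.
set V0 := V P1 P2 (phi 0) in Vphi; have V0_ge0 : 0 <= V0 by exact: V_ge0.
near=> t.
have t0 : 0 <= t by near: t; exact: nbhs_pinfty_ge.
(* The threshold comes from bounding the exponential of [delta * t] below by [delta * t]. *)
have tt : kappa ^+ 2 * V0 / (e ^+ 2 * delta) <= t.
  by near: t; apply: nbhs_pinfty_ge; exact: num_real.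
apply: le_trans (norm_le_V _) _.
rewrite -(@ler_pXn2r _ 2) ?nnegrE ?mulr_ge0 ?sqrtr_ge0 ?(ltW e0) //.
rewrite exprMn sqr_sqrtr ?V_ge0 //.
apply: (@le_trans _ _ (kappa ^+ 2 * (V0 * expR (- delta * t)))).
  by rewrite ler_wpM2l ?exprn_ge0 //; exact: Vphi.
rewrite mulNr expRN mulrA ler_pdivrMr ?expR_gt0 //.
move: tt; rewrite ler_pdivrMr ?mulr_gt0 ?exprn_gt0 // => tt.
apply: le_trans tt _; rewrite mulrCA ler_wpM2l ?exprn_ge0 ?(ltW e0) // mulrC.
by apply: le_trans (expR_ge1Dx _); rewrite lerDr.
Unshelve. all: by end_near. Qed.

Lemma sublevel_region_of_attraction delta : 0 < delta < c2 ->
  [set phi | V P1 P2 phi <= rho delta] `<=` region_of_attraction f.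
Proof.
move=> /andP[delta0 dc2] x0 /= V0.
have k0 : 0 <= kappa by rewrite addr_ge0 ?invr_ge0 ?sqrtr_ge0.
have d2 : 0 < delta / 2 by rewrite divr_gt0.
have d2d : delta / 2 < delta by lra.
(* [s] is the square root of [rho (delta / 2)]; on that sublevel set the coordinates are at most
   [kappa * s], the clipping radius. *)
pose s := (c2 - delta / 2) / c4 P1 P2 B L Q.
have s0 : 0 <= s by rewrite divr_ge0 ?(ltW c4_gt0) //; lra.
have clipE phi : V P1 P2 phi <= rho (delta / 2) -> clip (kappa * s) phi = phi.
  move=> Vphi; apply: clip_id => i; apply: le_trans (coord_le_V _ _) _.
  rewrite ler_wpM2l // -[s]ger0_norm // -sqrtr_sqr.
  exact: ler_wsqrtr.
have itv0 (t : R) : interior ([set` `[0, +oo[] : set R) t <-> 0 < t.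
  by rewrite interior_itv /= in_itv /= andbT.
split=> [|phi [cphi dphi] phi0].
  (* Existence: the clipped flow stays below [rho (delta / 2)], where clipping is the identity, and
     so solves the original equation. *)
  have [phi phi0 dphi] := aug_field_clip_flow A Q B L H x0 (mulr_ge0 k0 s0).
  have cphi : {within `[0, +oo[, continuous phi}.
    apply: derivable_within_continuous => t; rewrite in_itv /= andbT => t0.
    by have [] := dphi t t0.
  exists phi; split=> //; split=> // t /itv0 t0.
  have [|u u0 Vu|Vt _] := V_trajectory_decay d2 d2d dc2 cphi _ _ (ltW t0).
  - by rewrite phi0.
  - by have := dphi u (ltW u0); rewrite clipE.
  - by have := dphi t (ltW t0); rewrite clipE //; exact: ltW.
(* Convergence: the decay estimate applies directly to any trajectory from [x0]. *)
apply: (cvg_trajectory d2) => t t0.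
have [||_ //] := V_trajectory_decay d2 d2d dc2 cphi _ _ t0.
  by rewrite phi0.
by move=> u u0 _; apply: dphi; exact/itv0.
Qed.

End RegionOfAttraction.

(** * The closed loop: nondegeneracy of the data, positivity of the constants, and the estimate *)

Theorem lemma4 (R : realType) (np nc m : nat)
  (Ap : 'M[R]_np) (Bp : 'M[R]_(np, m)) (Qp : 'M[R]_np)
  (Ac : 'M[R]_nc) (Bc : 'cV[R]_nc) (Cc : 'M[R]_(m, nc)) (Dc : 'cV[R]_m)
  (lamp : 'I_np -> R[i]) (wp : 'I_np -> 'cV[R[i]]_np)
  (lamc : 'I_nc -> R[i]) (wc : 'I_nc -> 'cV[R[i]]_nc)
  (pistar pi : 'cV[R]_np) (gamma : R)
  (S Y W1 W2 P1 P2 : 'M[R]_(np + nc)) (L : 'cV[R]_(np + nc)) :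
  let A := clA Ap Bp Ac Cc in
  let B := clB Bp Bc Dc in
  let Q : 'M[R]_(np + nc) := clQ Qp in
  let H : 'rV[R]_(np + nc) := Hbar Qp pi in
  let F : 'M[R]_(np + nc) := A + B *m H in
  let f := aug_field A B Q H L in
  let c2 := c1 W1 W2 P1 P2 - c3 P1 P2 B L H in
  Qp^T = Qp ->
  eigenpairs Ap lamp wp ->
  eigenpairs Ac lamc wc ->
  Hurwitz A ->
  spectrum Ap `&` spectrum Ac = set0 ->
  Bp *m Cc != 0 ->
  pi = gamma *: pistar ->
  ~ Pi_unobs Ap Bp Qp Cc wp lamc wc pistar ->
  A^T *m S + S *m A = - Y ->
  posdef Y ->
  0 < gamma < lambda_min Y / (4 * norm2 (S *m B) * l2norm (Qp *m pistar)) ->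
  Hurwitz (F + L *m H) ->
  posdef W1 -> posdef W2 -> posdef P1 -> posdef P2 ->
  F^T *m P1 + P1 *m F = - W1 ->
  (F + L *m H)^T *m P2 + P2 *m (F + L *m H) = - W2 ->
  0 < c2 ->
  [/\ 0 < c1 W1 W2 P1 P2, 0 < c3 P1 P2 B L H & 0 < c4 P1 P2 B L Q] /\
  forall delta : R, 0 < delta < c2 ->
    let Omega : set 'cV[R]_((np + nc) + (np + nc)) :=
      [set phi | V P1 P2 phi <= ((c2 - delta) / c4 P1 P2 B L Q) ^+ 2] in
    [/\ Omega `<=` region_of_attraction f,
        V P1 P2 0 = 0 /\ (forall phi, phi != 0 -> 0 < V P1 P2 phi)
      & forall (J : interval R) (phi : R -> 'cV[R]_((np + nc) + (np + nc))),
          trajectory f J phi ->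
          forall t : R, interior [set` J] t -> interior Omega (phi t) ->
            derivable (V P1 P2 \o phi) t 1 /\
            derive1 (V P1 P2 \o phi) t <= - delta * V P1 P2 (phi t)].
Proof.
move=> A B Q H F f c2 symQ _ _ _ _ BC0 piE _ _ _ /andP[gamma0 gamma_lt].
move=> _ posW1 posW2 posP1 posP2 lyap1 lyap2 c2_gt0.
(* With no plant state [Bp *m Cc] would be an empty matrix, hence [0]. *)
have np_gt0 : (0 < np)%N.
  rewrite lt0n; apply: contra BC0 => /eqP np0; apply/eqP/matrixP => -[i lt_i].
  by exfalso; move: lt_i; rewrite np0.
have n_gt0 : (0 < np + nc)%N by rewrite addn_gt0 np_gt0.
(* Were one of these factors [0], the bound on [gamma] would be [x / 0 = 0]. *)
have den_neq0 : 4 * norm2 (S *m B) * l2norm (Qp *m pistar) != 0.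
  by apply: contraTneq (lt_trans gamma0 gamma_lt) => ->; rewrite invr0 mulr0 ltxx.
move: den_neq0; rewrite !mulf_eq0 !negb_or => /andP[/andP[_ SB0] Qpi0].
have B_neq0 : B != 0.
  by apply: contra SB0 => /eqP ->; rewrite mulmx0 norm2_eq0.
have Qp_pi0 : pistar^T *m Qp != 0.
  by rewrite -trmx_eq0 trmx_mul trmxK symQ -l2norm_eq0.
have Q_neq0 : Q != 0.
  apply: contra Qp_pi0 => /eqP; rewrite /Q /clQ -block_mx0 => /eq_block_mx[-> _ _ _].
  by rewrite mulmx0.
have H_neq0 : H != 0.
  apply: contra Qp_pi0 => /eqP; rewrite /H /Hbar -row_mx0 => /eq_row_mx[+ _].
  rewrite piE linearZ -scalemxAl scalerA => /eqP; rewrite scaler_eq0.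
  by rewrite mulf_eq0 pnatr_eq0 /= gt_eqF.
have P1B_neq0 : P1 *m B != 0.
  apply: contra B_neq0 => /eqP PB0.
  by rewrite -(mulKmx (posdef_unitmx posP1) B) PB0 mulmx0.
(* A nonzero column times a nonzero row has a nonzero entry. *)
have P1BH_neq0 : P1 *m B *m H != 0.
  have [i P1Bi] : exists i, (P1 *m B) i 0 != 0.
    apply/existsP; apply: contraR P1B_neq0 => /existsPn P1B0.
    by apply/eqP/colP => i; rewrite [RHS]mxE; apply/eqP/negPn/P1B0.
  have [j Hj] : exists j, H 0 j != 0.
    apply/existsP; apply: contraR H_neq0 => /existsPn H0.
    by apply/eqP/rowP => j; rewrite [RHS]mxE; apply/eqP/negPn/H0.
  apply: contraTneq (mulf_neq0 P1Bi Hj) => PBH0.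
  have /matrixP/(_ i j) := PBH0; rewrite [LHS]mxE big_ord1 [RHS]mxE => ->.
  by rewrite eqxx.
have lam1 := lambda_min_gt0 n_gt0 posP1.
have lam2 := lambda_min_gt0 n_gt0 posP2.
(* The first summand is positive and the other two are nonnegative. *)
have c4_gt0 : 0 < c4 P1 P2 B L Q.
  rewrite /c4 -addrA ltr_wpDr //.
    by rewrite addr_ge0 // divr_ge0 ?mulr_ge0 ?norm2_ge0 ?sqrtr_ge0 ?powR_ge0 ?(ltW lam2).
  by rewrite divr_gt0 ?mulr_gt0 ?norm2_gt0 ?powR_gt0.
split.
  split=> //; first exact: c1_gt0.
  rewrite divr_gt0 ?sqrtr_gt0 ?mulr_gt0 // ltr_wpDr ?mulr_ge0 ?norm2_ge0 //.
  by rewrite mulr_gt0 // norm2_gt0.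
move=> delta delta_c2 Omega; split.
- exact: sublevel_region_of_attraction.
- split; last by move=> phi; exact: V_gt0.
  by rewrite /V !raddf0 ?mulmx0 ?addr0 mxE.
- move=> J phi [_ dphi] t Jt /interior_subset Omega_t.
  have [dV VE] : is_derive t 1 (V P1 P2 \o phi) (Vdot A Q P1 P2 B L H (phi t)).
    by apply: is_derive_V; [exact: posP1.1|exact: posP2.1|exact: dphi].
  split=> //; rewrite derive1E VE.
  apply: (Vdot_le_decay lyap1 lyap2 posP1 posP2 posW1 posW2 n_gt0 c4_gt0 _ Omega_t).
  by have /andP[_ /ltW] := delta_c2.
Qed.
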